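(* Let $n\ge2$, let $\Omega\subset\mathbb R^{n+1}$ be an open set satisfying the corkscrew condition with $n$-Ahlfors regular boundary $\partial\Omega$ such that either $\Omega$ is bounded or $\partial\Omega$ is unbounded. Let $0<p\le1$ and $f\in L^\infty_c(\Omega)\cap T^p_2(\Omega)$. Then there exist a sequence of real numbers $(\lambda_j)_j$ and a sequence of $T^p_2$ atoms $(a_j)_j$ such that $$f=\sum_j\lambda_ja_j\ \text{ in }T^p_2(\Omega)\qquad\text{and}\qquad\sum_j|\lambda_j|^p\le C\|f\|_{T^p_2(\Omega)}^p,$$ where $C>0$ only depends on the Ahlfors regularity constant of $\partial\Omega$ and the corkscrew constant of $\Omega$ (with $n$, $p$ and the aperture fixed); in particular $C$ does not depend on $f$.
   Context: $\sigma:=\mathcal H^n|_{\partial\Omega}$, $\delta_\Omega(x)=\operatorname{dist}(x,\partial\Omega)$. A closed set $E$ is $n$-Ahlfors regular if there is $C_0>0$ with $C_0^{-1}r^n\le\mathcal H^n(E\cap B(x,r))\le C_0r^n$ for $x\in E$, $0<r\le\operatorname{diam}E$. $\Omega$ satisfies the corkscrew condition if there is $c>0$ such that for all $x\in\partial\Omega$, $r\in(0,2\operatorname{diam}\Omega)$ there is a ball $B\subset B(x,r)\cap\Omega$ of radius at least $cr$. $L^\infty_c(\Omega)$ is the space of bounded functions with compact support in $\Omega$. For a fixed aperture $\alpha>0$ and $\xi\in\partial\Omega$, $\gamma_\alpha(\xi)=\{y\in\Omega:|\xi-y|<(1+\alpha)\delta_\Omega(y)\}$ and $\mathcal A(g)(\xi)=\Big(\int_{\gamma_\alpha(\xi)}|g(x)|^2\frac{dx}{\delta_\Omega(x)^{n+1}}\Big)^{1/2}$.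 The tent space is $T^p_2(\Omega)=\{g\in L^2_{loc}(\Omega):\mathcal A(g)\in L^p(\sigma)\}$ with $\|g\|_{T^p_2(\Omega)}=\|\mathcal A(g)\|_{L^p(\sigma)}$ (different apertures give comparable norms). For $0<p\le1$, a $T^p_2$ atom is a function $a$ supported in $B\cap\Omega$ for some ball $B=B(\xi,R)$ with $\xi\in\partial\Omega$, $0<R<\operatorname{diam}\partial\Omega$, such that $\int_{B\cap\Omega}a(x)^2\frac{dx}{\delta_\Omega(x)}\le\sigma(B\cap\partial\Omega)^{1-2/p}$. *)

(* Defs.v *)
From HB Require Import structures.
From mathcomp Require Import all_boot all_order all_algebra.
From mathcomp Require Import all_classical all_reals all_analysis.
From mathcomp Require Import measurable_realfun.

Set Implicit Arguments.
Unset Strict Implicit.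
Unset Printing Implicit Defensive.

Import Order.TTheory GRing.Theory Num.Theory.
Import numFieldNormedType.Exports.

Local Open Scope classical_set_scope.
Local Open Scope ring_scope.

(* The library norm, balls and diameters on 'rV[R]_d are those of the sup norm,
   so the Euclidean ones are defined here; the topology is the same, and
   open, closed, compact and bounded_set are the library notions. *)
Section euclidean.
Context {R : realType} {d : nat}.
Implicit Types (x y : 'rV[R]_d) (A : set 'rV[R]_d).

Definition enorm x : R := Num.sqrt (\sum_(i < d) x ord0 i ^+ 2).

Definition eball x (r : R) : set 'rV[R]_d := [set y | enorm (x - y) < r].

(* The maximum with 0 makes the diameter of the empty set 0 instead of -oo. *)
Definition ediam A : \bar R :=
  maxe 0%E (ereal_sup [set (enorm (x - y))%:E | x in A & y in A]).

Definition bdry A : set 'rV[R]_d := closure A `\` A°.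

(* The distance to the boundary of A, meaningful when bdry A is nonempty. *)
Definition delta A x : R := inf [set enorm (x - y) | y in bdry A].

End euclidean.

(* Outer measure built from the sets B i, P i, with weights w i, by countable
   covers. *)
Section cover_outer.
Context {R : realType} {T I : Type}.
Variables (P : set I) (B : I -> set T) (w : I -> \bar R).
Local Open Scope ereal_scope.

Definition cover_by (X : set T) : set (nat -> I) :=
  [set i | (forall k, P (i k)) /\ X `<=` \bigcup_k B (i k)].

Definition cover_outer (X : set T) : \bar R :=
  ereal_inf [set \sum_(k <oo) w (i k) | i in cover_by X].

Hypothesis w_ge0 : forall i, P i -> 0 <= w i.

Lemma cover_outer_ge0 X : 0 <= cover_outer X.
Proof.
apply: le_ereal_inf_tmp => _ [i [Pi _] <-].
by apply: nneseries_ge0 => k _ _; exact: w_ge0.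
Qed.

Lemma le_cover_outer : {homo cover_outer : X Y / X `<=` Y >-> X <= Y}.
Proof.
move=> X Y XY; apply/ereal_inf_le_tmp => _ [i [Pi Yi] <-].
by exists i => //; split => //; exact: subset_trans XY Yi.
Qed.

Lemma cover_outer0 i0 : P i0 -> w i0 = 0 -> cover_outer set0 = 0.
Proof.
move=> Pi0 wi0; apply/eqP; rewrite eq_le cover_outer_ge0 andbT.
apply: ereal_inf_lbound; exists (fun=> i0); first by split.
by rewrite eseries0.
Qed.

Lemma cover_outer_sigma_subadditive : sigma_subadditive cover_outer.
Proof.
move=> A; have [[i ioo]|] := pselect (exists i, cover_outer (A i) = +oo).
  rewrite (eseries_pinfty _ _ ioo) ?leey// => n _.
  by rewrite -ltNye (lt_le_trans _ (cover_outer_ge0 _)).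
rewrite -forallNE => Aoo.
suff add2e (e : {posnum R}) :
    cover_outer (\bigcup_n A n) <= \sum_(i <oo) cover_outer (A i) + e%:num%:E.
  by apply/lee_addgt0Pr => _/posnumP[].
rewrite (le_trans _ (epsilon_trick _ _ _))//; last first.
  by move=> n; exact: cover_outer_ge0.
pose Q n (i : nat -> I) := cover_by (A n) i /\
  \sum_(k <oo) w (i k) <= cover_outer (A n) + (e%:num / (2 ^ n.+1)%:R)%:E.
have [G QG] : {G : nat -> nat -> I & forall n, Q n (G n)}.
  apply: (@choice _ _ Q) => n; rewrite /Q /cover_outer.
  set S := (X in ereal_inf X); move infS : (ereal_inf S) => iS.
  case: iS infS => [r Sr|Soo|Soo].
  - have en1 : (0 < e%:num / (2 ^ n.+1)%:R)%R by [].
    have /(lb_ereal_inf_adherent en1) : ereal_inf S \is a fin_num by rewrite Sr.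
    move=> [x [i iA iE xS]].
    by exists i; split => //; rewrite iE -Sr; exact/ltW.
  - by have := Aoo n; rewrite /cover_outer Soo.
  - suff : lbound S 0 by move/le_ereal_inf_tmp; rewrite Soo.
    move=> /= _ [i [Pi _] <-].
    by apply: nneseries_ge0 => k _ _; exact: w_ge0.
have G_ge0 x : 0 <= (w \o uncurry G) x.
  by case: x => n k /=; apply: w_ge0; exact: (QG n).1.1.
apply: (@le_trans _ _ (\esum_(i in setT) (w \o uncurry G) i)).
  apply: ereal_inf_lbound => /=.
  have /card_esym/ppcard_eqP[f] := card_nat2.
  exists (uncurry G \o f).
    split => [k|t [n _ /(QG n).1.2 [k _ Bt]]] /=.
      by case: (f k) => a b; exact: (QG a).1.1.
    by exists (f^-1%FUN (n, k)) => //=; rewrite invK ?inE.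
  rewrite -(esum_pred_image (w \o uncurry G) _ xpredT) ?[fun=> _]set_true//.
  by rewrite image_eq.
rewrite (_ : esum _ _ = \sum_(i <oo) \sum_(j <oo) w (G i j)); last first.
  pose J : nat -> set (nat * nat) := fun i => [set (i, j) | j in setT].
  rewrite (_ : setT = \bigcup_k J k); last first.
    by rewrite predeqE => -[a b]; split => // _; exists a => //; exists b.
  rewrite esum_bigcupT /=; last 2 first.
    - apply/trivIsetP => i j _ _ ij.
      rewrite predeqE => -[n m] /=; split => //= -[] [_] _ [<-{n} _].
      by move=> [m' _] [] /esym/eqP; rewrite (negbTE ij).
    - by move=> /= x; exact: G_ge0.
  rewrite -(image_id [set: nat]) -fun_true esum_pred_image//; last first.
    by move=> n _; apply: esum_ge0 => x _; exact: G_ge0.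
  apply: eq_eseriesr => /= j _.
  rewrite -(esum_pred_image (w \o uncurry G) (pair j) predT)//=; last first.
    by move=> ? ? _ _; exact: (@can_inj _ _ _ snd).
    by move=> n _; exact: (G_ge0 (j, n)).
  by congr esum; rewrite predeqE => -[a b]; split; move=> [i _ <-]; exists i.
apply: lee_lim.
- apply: is_cvg_nneseries => n *.
  by apply: nneseries_ge0 => m *; exact: (G_ge0 (n, m)).
- apply: is_cvg_nneseries => n *; apply: adde_ge0 => //.
  exact: cover_outer_ge0.
- by near=> n; apply: lee_sum => i _; exact: (QG i).2.
Unshelve. all: by end_near. Qed.

End cover_outer.

(* Lebesgue measure on R^(d+1): the Caratheodory measure of the outer measure
   given by covers by half-open boxes; its measurable sets are the Lebesgue
   measurable sets. *)
Section lebesgue.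
Context {R : realType} {d : nat}.

Definition box (ab : 'rV[R]_d.+1 * 'rV[R]_d.+1) : set 'rV[R]_d.+1 :=
  [set x | forall i, ab.1 ord0 i < x ord0 i <= ab.2 ord0 i].

Definition box_proper : set ('rV[R]_d.+1 * 'rV[R]_d.+1) :=
  [set ab : 'rV[R]_d.+1 * 'rV[R]_d.+1 |
     forall i, ab.1 ord0 i <= ab.2 ord0 i].

Definition box_vol (ab : 'rV[R]_d.+1 * 'rV[R]_d.+1) : \bar R :=
  (\prod_(i < d.+1) (ab.2 ord0 i - ab.1 ord0 i))%:E.

Definition leb_outer : set 'rV[R]_d.+1 -> \bar R :=
  cover_outer box_proper box box_vol.

Lemma box_vol_ge0 ab : box_proper ab -> (0 <= box_vol ab)%E.
Proof. by move=> Pab; rewrite lee_fin prodr_ge0// => i _; rewrite subr_ge0. Qed.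

Lemma leb_outer0 : leb_outer set0 = 0%E.
Proof.
apply: (cover_outer0 _ box_vol_ge0 (i0 := (0, 0))); first by move=> i /=.
by rewrite /box_vol big_ord_recl/= mxE subrr mul0r.
Qed.

HB.instance Definition _ := isOuterMeasure.Build R 'rV[R]_d.+1 leb_outer
  leb_outer0 (cover_outer_ge0 box box_vol_ge0)
  (@le_cover_outer _ _ _ box_proper box box_vol)
  (cover_outer_sigma_subadditive box box_vol_ge0).

Definition leb : {measure set (caratheodory_type leb_outer) -> \bar R} :=
  (leb_outer : {outer_measure set 'rV[R]_d.+1 -> \bar R}).

End lebesgue.

(* Volume of the unit ball of R^n, by the recursion
   omega_n = (2 pi / n) omega_(n-2). *)
Fixpoint unit_ball_vol (R : realType) (n : nat) : R :=
  match n with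
  | 0 => 1
  | 1 => 2
  | m.+2 => 2 * pi / m.+2%:R * unit_ball_vol R m
  end.

(* The n-dimensional Hausdorff measure on R^d, as an outer measure, with the
   usual normalization (omega_n / 2^n) (diam U)^n of the weights. *)
Section hausdorff.
Context {R : realType} {d : nat}.
Variable n : nat.
Local Open Scope ereal_scope.

Definition hausdorff_weight (U : set 'rV[R]_d) : \bar R :=
  if `[< U = set0 >] then 0
  else (unit_ball_vol R n / 2 ^+ n)%:E * ediam U ^+ n.

Definition hausdorff_delta (e : R) : set 'rV[R]_d -> \bar R :=
  cover_outer [set U | ediam U <= e%:E] id hausdorff_weight.

Definition hausdorff (X : set 'rV[R]_d) : \bar R :=
  ereal_sup [set hausdorff_delta e X | e in [set e : R | (0 < e)%R]].

Lemma ediam_ge0 (U : set 'rV[R]_d) : 0 <= ediam U.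
Proof. by rewrite /ediam le_max lexx. Qed.

Lemma unit_ball_vol_ge0 m : (0 <= unit_ball_vol R m)%R.
Proof.
suff: (0 <= unit_ball_vol R m)%R /\ (0 <= unit_ball_vol R m.+1)%R by case.
elim: m => [|m [IH1 IH2]] //=; split => //=.
by rewrite mulr_ge0// divr_ge0// mulr_ge0// pi_ge0.
Qed.

Lemma hausdorff_weight_ge0 U : 0 <= hausdorff_weight U.
Proof.
rewrite /hausdorff_weight; case: ifPn => // _.
rewrite mule_ge0 ?expe_ge0 ?ediam_ge0//.
by rewrite lee_fin divr_ge0 ?unit_ball_vol_ge0// exprn_ge0.
Qed.

Lemma hausdorff_delta_ge0 e X : 0 <= hausdorff_delta e X.
Proof. by apply: cover_outer_ge0 => U _; exact: hausdorff_weight_ge0. Qed.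

Lemma hausdorff_delta0 e : (0 < e)%R -> hausdorff_delta e set0 = 0.
Proof.
move=> e0; apply: (@cover_outer0 _ _ _ _ _ _ _ set0) => [U _|/=|] //.
- exact: hausdorff_weight_ge0.
- rewrite /ediam (_ : [set _ | _ in _ & _ in _] = set0) ?ereal_sup0.
    by rewrite maxeNy lee_fin ltW.
  by rewrite predeqE => t; split => // -[? []].
- by rewrite /hausdorff_weight asboolT.
Qed.

Lemma le_hausdorff : {homo hausdorff : X Y / X `<=` Y >-> X <= Y}.
Proof.
move=> X Y XY; apply: ge_ereal_sup => _ [e e0 <-].
apply: le_trans (le_cover_outer _ _ _ XY) _.
by apply: ereal_sup_ubound; exists e.
Qed.

Lemma hausdorff_ge0 X : 0 <= hausdorff X.
Proof.
apply: le_trans (hausdorff_delta_ge0 1 X) _.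
by apply: ereal_sup_ubound; exists 1%R => //=.
Qed.

Lemma hausdorff0 : hausdorff set0 = 0.
Proof.
apply/eqP; rewrite eq_le hausdorff_ge0 andbT.
by apply: ge_ereal_sup => _ [e e0 <-]; rewrite hausdorff_delta0.
Qed.

Lemma hausdorff_sigma_subadditive : sigma_subadditive hausdorff.
Proof.
move=> A; apply: ge_ereal_sup => _ [e e0 <-].
have w_ge0 U : [set U : set 'rV[R]_d | ediam U <= e%:E] U ->
  0 <= hausdorff_weight U by move=> _; exact: hausdorff_weight_ge0.
apply: le_trans (cover_outer_sigma_subadditive id w_ge0 A) _.
apply: lee_nneseries => [k _ _|k _]; first exact: hausdorff_delta_ge0.
by apply: ereal_sup_ubound; exists e.
Qed.

HB.instance Definition _ := isOuterMeasure.Build R 'rV[R]_d hausdorff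
  hausdorff0 hausdorff_ge0 le_hausdorff hausdorff_sigma_subadditive.

End hausdorff.

Section surface_measure.
Context {R : realType} {n : nat}.
Variable Omega : set 'rV[R]_n.+1.
Local Open Scope ereal_scope.

(* sigma = H^n restricted to the boundary of Omega, first as an outer measure,
   then as a measure on its Caratheodory sigma-algebra. *)
Definition sigma_outer (X : set 'rV[R]_n.+1) : \bar R :=
  hausdorff n (X `&` bdry Omega).

Lemma sigma_outer0 : sigma_outer set0 = 0.
Proof. by rewrite /sigma_outer set0I outer_measure0. Qed.

Lemma sigma_outer_ge0 X : 0 <= sigma_outer X.
Proof. exact: outer_measure_ge0. Qed.

Lemma le_sigma_outer : {homo sigma_outer : X Y / X `<=` Y >-> X <= Y}.
Proof. by move=> X Y XY; apply: le_outer_measure; exact: setSI. Qed.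

Lemma sigma_outer_sigma_subadditive : sigma_subadditive sigma_outer.
Proof.
move=> A; rewrite /sigma_outer setI_bigcupl.
exact: outer_measure_sigma_subadditive.
Qed.

HB.instance Definition _ := isOuterMeasure.Build R 'rV[R]_n.+1 sigma_outer
  sigma_outer0 sigma_outer_ge0 le_sigma_outer sigma_outer_sigma_subadditive.

Definition sigma : {measure set (caratheodory_type sigma_outer) -> \bar R} :=
  (sigma_outer : {outer_measure set 'rV[R]_n.+1 -> \bar R}).

End surface_measure.

Section geometry.
Context {R : realType} {n : nat}.
Implicit Types Omega E : set 'rV[R]_n.+1.

Definition ahlfors_regular (C0 : R) E : Prop :=
  closed E /\
  forall x (r : R), E x -> 0 < r -> (r%:E <= ediam E)%E ->
    ((C0^-1 * r ^+ n)%:E <= hausdorff n (E `&` eball x r)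
                         <= (C0 * r ^+ n)%:E)%E.

Definition corkscrew (c : R) Omega : Prop :=
  forall x (r : R), bdry Omega x -> 0 < r -> (r%:E < 2%:E * ediam Omega)%E ->
    exists z (s : R), c * r <= s /\ eball z s `<=` eball x r `&` Omega.

End geometry.

(* Functions on Omega are represented by functions on the whole space, of which
   only the restriction to Omega matters. *)
Section tent_spaces.
Context {R : realType} {n : nat}.
Variables (alpha p : R) (Omega : set 'rV[R]_n.+1).
Implicit Types f g a : 'rV[R]_n.+1 -> R.

Definition Omega_measurable g : Prop :=
  measurable_fun (Omega : set (caratheodory_type leb_outer)) g.

(* Boundedness and support are essential ones, as for classes of functions
   modulo null sets. *)
Definition Linfty_c f : Prop :=
  [/\ Omega_measurable f,
      exists M : R, {ae leb, forall x, Omega x -> `|f x| <= M} &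
      exists K : set 'rV[R]_n.+1, [/\ compact K, K `<=` Omega &
        {ae leb, forall x, Omega x -> ~ K x -> f x = 0}]].

Definition L2_loc g : Prop :=
  Omega_measurable g /\
  forall K : set 'rV[R]_n.+1, compact K -> K `<=` Omega ->
    (\int[leb]_(x in K) (g x ^+ 2)%:E < +oo)%E.

Definition cone (xi : 'rV[R]_n.+1) : set 'rV[R]_n.+1 :=
  [set y | Omega y /\ enorm (xi - y) < (1 + alpha) * delta Omega y].

Definition area g (xi : 'rV[R]_n.+1) : \bar R :=
  ((\int[leb]_(x in cone xi) (g x ^+ 2 / delta Omega x ^+ n.+1)%:E)
    `^ (2^-1))%E.

Definition tent_norm g : \bar R := 'N[sigma Omega]_(p%:E) [area g].

Definition tent_space g : Prop :=
  [/\ L2_loc g,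
      measurable_fun setT
        (area g : caratheodory_type (sigma_outer Omega) -> \bar R) &
      (tent_norm g < +oo)%E].

(* The right-hand side power has exponent 1 - 2 / p < 0; sigma of a ball
   centered on the boundary is positive and finite whenever the boundary is
   Ahlfors regular, so the conventions at 0 and +oo play no role. *)
Definition tent_atom a : Prop :=
  Omega_measurable a /\
  exists xi (r : R), [/\ bdry Omega xi, 0 < r, (r%:E < ediam (bdry Omega))%E,
    forall x, ~ (eball xi r `&` Omega) x -> a x = 0 &
    (\int[leb]_(x in eball xi r `&` Omega) (a x ^+ 2 / delta Omega x)%:E
      <= sigma Omega (eball xi r `&` bdry Omega) `^ (1 - 2 / p))%E].

Definition tent_cvg (s : nat -> 'rV[R]_n.+1 -> R) f : Prop :=
  [/\ forall N, tent_space (s N), tent_space f &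
      (fun N => tent_norm (fun x => f x - s N x)) @ \oo --> 0%E].

End tent_spaces.

(* Main.v *)
Require Import Defs.
From mathcomp Require Import all_boot all_order all_algebra.
From mathcomp Require Import all_classical all_reals all_analysis.
From mathcomp Require Import measurable_realfun.
From mathcomp Require Import ring lra.

(** The proof is a discrete form of the Coifman-Meyer-Stein decomposition.

    Let f vanish almost everywhere off the compact set K. Cut K into finitely
    many disjoint pieces P_i, so small compared with their distance to the
    boundary that each of them lies in the cone at every boundary point of a
    ball b_i centred at an almost nearest boundary point, with radius r_i
    proportional to that distance. Put w_i = \int_(P_i) f^2 / delta. Then the
    finite sum S = \sum_i (w_i / sigma(b_i)) 1_(b_i) is at most a constant times
    A(f)^2 [dsq_le_area], whereas the atom condition for f restricted to a union
    of pieces only involves the sum of their w_i [grouped_atom]. What remains is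
    a statement about finitely many weighted balls [discrete_decomposition]: to
    group them so that the integral of S^(p/2) controls the sum of the p-th
    powers of the coefficients.

    Let E_k = {S^(p/2) > theta 2^k}. Each ball has a level k such that at least
    half of it lies in E_k and at least half of it outside E_(k+1)
    [stopping_levels]. Among the balls of a given level, choose disjoint leaders
    greedily by decreasing radius, and attach to each ball a leader of its level
    which it meets and which is at least as large [greedy_selection]. Off
    E_(k+1), S is at most (theta 2^(k+1))^(2/p); as half of each ball lies there,
    integrating S over an enlarged leader minus E_(k+1) bounds the total weight
    of its group [group_weight_le]. The p-th power of the coefficient of a group
    with leader b_l is then at most a constant times theta 2^k sigma(b_l), hence
    at most a constant times theta 2^k sigma(b_l :&: E_k). Leaders of one level
    are disjoint, so at a given point x the terms theta 2^k 1_(b_l :&: E_k)(x)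
    have distinct levels k with theta 2^k < S(x)^(p/2), and their sum is at most
    2 S(x)^(p/2) [stopped_overlap].

    An atom must be supported in a ball of radius less than the diameter of the
    boundary. Every boundary point is the centre of such a ball containing K
    [compact_in_boundary_ball], so the enlarged leaders can be capped without
    losing any piece.

    The resulting sum is finite and equals f almost everywhere, so convergence in
    the tent space only requires that partial sums belong to it; they are
    dominated by f, and the superlevel sets of their area functions are open
    [open_area_sq_gt]. Open sets are measurable for Lebesgue measure because
    half-spaces cut boxes into boxes [box_split], and for Hausdorff measure
    because that measure is additive on sets separated by a slab
    [halfspace_caratheodory]. *)

Set Implicit Arguments.
Unset Strict Implicit.
Unset Printing Implicit Defensive.

Import Order.TTheory GRing.Theory Num.Theory.
Import numFieldNormedType.Exports.

Local Open Scope classical_set_scope.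
Local Open Scope ring_scope.

(** * The Euclidean norm *)

Section euclidean_norm.
Context {R : realType} {d : nat}.
Implicit Types (x y z : 'rV[R]_d).

Lemma enorm_ge0 x : 0 <= enorm x. Proof. exact: sqrtr_ge0. Qed.

Let sqsum_ge0 x : 0 <= \sum_(i < d) x ord0 i ^+ 2.
Proof. by apply: sumr_ge0 => i _; exact: sqr_ge0. Qed.

Lemma sqr_enorm x : enorm x ^+ 2 = \sum_(i < d) x ord0 i ^+ 2.
Proof. by rewrite sqr_sqrtr. Qed.

Lemma coord_le_enorm x i : `|x ord0 i| <= enorm x.
Proof.
rewrite -sqrtr_sqr ler_wsqrtr// (bigD1 i)//= lerDl.
by apply: sumr_ge0 => j _; exact: sqr_ge0.
Qed.

Lemma enorm_eq0 x : enorm x = 0 -> x = 0.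
Proof.
move=> x0; apply/rowP => i; rewrite mxE; apply/normr0_eq0/eqP.
by rewrite eq_le normr_ge0 andbT -x0 coord_le_enorm.
Qed.

Lemma enorm0 : enorm (0 : 'rV[R]_d) = 0.
Proof. by rewrite /enorm big1 ?sqrtr0// => i _; rewrite mxE expr0n. Qed.

Lemma enormZ (a : R) x : enorm (a *: x) = `|a| * enorm x.
Proof.
rewrite /enorm -sqrtr_sqr -sqrtrM ?sqr_ge0// mulr_sumr; congr Num.sqrt.
by apply: eq_bigr => i _; rewrite mxE exprMn.
Qed.

Lemma enormN x : enorm (- x) = enorm x.
Proof. by rewrite -scaleN1r enormZ normrN1 mul1r. Qed.

Lemma enormB x y : enorm (x - y) = enorm (y - x).
Proof. by rewrite -enormN opprB. Qed.

(** The Cauchy-Schwarz inequality, by summing 2 s t <= s^2 + t^2 over the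
    coordinates of the normalized vectors. *)
Lemma enorm_dot x y : \sum_(i < d) x ord0 i * y ord0 i <= enorm x * enorm y.
Proof.
have [x0|x0] := eqVneq (enorm x) 0.
  rewrite x0 mul0r big1// => i _.
  by rewrite (enorm_eq0 x0) mxE mul0r.
have [y0|y0] := eqVneq (enorm y) 0.
  rewrite y0 mulr0 big1// => i _.
  by rewrite (enorm_eq0 y0) mxE mulr0.
have xp : 0 < enorm x by rewrite lt_def x0 enorm_ge0.
have yp : 0 < enorm y by rewrite lt_def y0 enorm_ge0.
have -> : enorm x * enorm y = \sum_(i < d) enorm x * enorm y / 2 *
    (x ord0 i ^+ 2 / enorm x ^+ 2 + y ord0 i ^+ 2 / enorm y ^+ 2).
  rewrite -mulr_sumr big_split/= -!mulr_suml -!sqr_enorm.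
  by field; rewrite ?x0 ?y0.
apply: ler_sum => i _.
rewrite -subr_ge0.
have -> : enorm x * enorm y / 2 *
    (x ord0 i ^+ 2 / enorm x ^+ 2 + y ord0 i ^+ 2 / enorm y ^+ 2) -
    x ord0 i * y ord0 i = enorm x * enorm y / 2 *
    (x ord0 i / enorm x - y ord0 i / enorm y) ^+ 2.
  by field; rewrite ?x0 ?y0.
by rewrite mulr_ge0 ?sqr_ge0// divr_ge0// mulr_ge0 ?enorm_ge0.
Qed.

Lemma enormD x y : enorm (x + y) <= enorm x + enorm y.
Proof.
rewrite -ler_sqr ?nnegrE ?addr_ge0 ?enorm_ge0// sqrrD !sqr_enorm.
have -> : \sum_(i < d) (x + y) ord0 i ^+ 2 = \sum_(i < d) x ord0 i ^+ 2 +
    (\sum_(i < d) x ord0 i * y ord0 i) *+ 2 + \sum_(i < d) y ord0 i ^+ 2.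
  rewrite -sumrMnl -!big_split/=; apply: eq_bigr => i _.
  by rewrite mxE sqrrD.
by rewrite lerD2r lerD2l lerMn2r/= enorm_dot.
Qed.

Lemma enorm_triangle z x y : enorm (x - y) <= enorm (x - z) + enorm (z - y).
Proof. by rewrite (le_trans _ (enormD _ _))// addrA subrK. Qed.

Lemma norm_le_enorm x : `|x| <= enorm x.
Proof.
rewrite /Num.norm/= mx_normrE; apply/bigmax_leP; split; first exact: enorm_ge0.
by move=> [i j] _ /=; rewrite ord1 coord_le_enorm.
Qed.

Lemma enorm_continuous : continuous (@enorm R d).
Proof.
have sum_cont (r : seq 'I_d) :
    continuous (fun x : 'rV[R]_d => \sum_(i <- r) x ord0 i ^+ 2).
  elim: r => [|i r IH].
    rewrite (_ : (fun x : 'rV[R]_d => _) = cst 0); first exact: cst_continuous.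
    by apply/funext => x; rewrite big_nil.
  rewrite (_ : (fun x : 'rV[R]_d => _) = (fun x : 'rV[R]_d => x ord0 i * x ord0 i) \+
      (fun x : 'rV[R]_d => \sum_(j <- r) x ord0 j ^+ 2)); last first.
    by apply/funext => x; rewrite big_cons expr2.
  move=> x; apply: continuousD; last exact: IH.
  by apply: continuousM; exact: coord_continuous.
move=> x; apply: (@continuous_comp _ _ _ (fun x : 'rV[R]_d =>
  \sum_(i < d) x ord0 i ^+ 2) Num.sqrt); last exact: sqrt_continuous.
exact: sum_cont.
Qed.

Lemma enormB_continuous (xi : 'rV[R]_d) : continuous (fun x => enorm (x - xi)).
Proof.
move=> x; apply: (@continuous_comp _ _ _ (fun x => x - xi) (@enorm R d)).
  apply: (continuousB (f := fun x : 'rV[R]_d => x) (g := fun=> xi)).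
    exact: cvg_id.
  exact: cst_continuous.
exact: enorm_continuous.
Qed.

Lemma open_eball x r : open (eball x r).
Proof.
rewrite (_ : eball x r = (fun y => enorm (y - x)) @^-1` [set t | t < r]).
  by apply: open_comp => [y _|]; [exact: enormB_continuous|exact: open_lt].
by apply/seteqP; split => y; rewrite /eball/= enormB.
Qed.

Lemma eball_center x r : 0 < r -> eball x r x.
Proof. by rewrite /eball/= subrr enorm0. Qed.

Lemma eball_in_open (U : set 'rV[R]_d) x : open U -> U x ->
  exists2 s, 0 < s & eball x s `<=` U.
Proof.
rewrite openE => /(_ x)/[apply] /nbhs_ballP[s /= s0 sU]; exists s => // y xy.
apply: sU; rewrite -ball_normE/=; exact: le_lt_trans (norm_le_enorm _) xy.
Qed.

End euclidean_norm.

(** * Boundary, distance to the boundary, and diameter *)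

Section farthest_points.
Context {R : realType} {n : nat}.
Implicit Types (Omega K : set 'rV[R]_n.+1) (x y xi : 'rV[R]_n.+1).

Lemma bdryNopen Omega x : open Omega -> bdry Omega x -> ~ Omega x.
Proof. by move=> oO [_]; rewrite (interior_id _).1. Qed.

Lemma exists_farther Omega x xi : open Omega -> Omega x -> x <> xi ->
  exists2 y, Omega y & enorm (x - xi) < enorm (y - xi).
Proof.
move=> oO Ox xxi; have [s s0 sO] := eball_in_open oO Ox.
have a0 : 0 < enorm (x - xi).
  rewrite lt_def enorm_ge0 andbT; apply/eqP => /enorm_eq0/eqP.
  by rewrite subr_eq0 => /eqP.
pose t := s / (2 * enorm (x - xi)).
have t0 : 0 < t by rewrite divr_gt0// mulr_gt0.
exists (x + t *: (x - xi)).
  apply: sO; rewrite /eball/= opprD addrA subrr add0r enormN enormZ gtr0_norm//.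
  rewrite (_ : _ * _ = s / 2); first by lra.
  by rewrite /t; field; rewrite gt_eqF.
have -> : x + t *: (x - xi) - xi = (1 + t) *: (x - xi).
  by rewrite scalerDl scale1r addrAC.
by rewrite enormZ gtr0_norm ?addr_gt0// ltr_pMl// ltrDl.
Qed.

(** A point of the closure of [Omega] at maximal distance from [xi] cannot be
    interior, since [exists_farther] would improve it. *)
Lemma bounded_open_far_boundary Omega x xi : open Omega -> bounded_set Omega ->
  Omega x -> x <> xi ->
  exists2 y, bdry Omega y & enorm (x - xi) < enorm (y - xi).
Proof.
move=> oO [M [Mr bO]] Ox xxi.
have cl : compact (closure Omega).
  apply: bounded_closed_compact; last exact: closed_closure.
  exists M; split => // r Mr' y /(closureS (bO r Mr')).
  rewrite [X in closure X](_ : _ = closed_ball_ Num.norm 0 r); last first.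
    by apply/seteqP; split => z; rewrite /closed_ball_/= sub0r normrN.
  by rewrite -(closure_id _).1 ?/closed_ball_/= ?sub0r ?normrN//; exact: closed_closed_ball_.
have [||c] := compact_EVT_max (f := fun y => enorm (y - xi)) _ cl.
- by exists x; exact: subset_closure.
- by apply: continuous_subspaceT; exact: enormB_continuous.
move=> /set_mem clc cmax.
have le_c y : Omega y -> enorm (y - xi) <= enorm (c - xi).
  by move=> Oy; apply: cmax; exact/mem_set/subset_closure.
have [y Oy xy] := exists_farther oO Ox xxi.
exists c; last exact: lt_le_trans xy (le_c _ Oy).
split => //; rewrite (interior_id _).1// => Oc.
have [|z Oz cz] := exists_farther oO Oc (xi := xi).
  move=> cxi; have := lt_le_trans xy (le_c _ Oy).
  by rewrite cxi subrr enorm0 ltNge enorm_ge0.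
by have := le_c _ Oz; rewrite leNgt cz.
Qed.

End farthest_points.

Lemma exists_fin_between (R : realType) (a : R) (D : \bar R) : (a%:E < D)%E ->
  exists2 r, a < r & (r%:E < D)%E.
Proof.
case: D => [D||//]; last by move=> _; exists (a + 1); rewrite ?ltrDl// ltry.
by rewrite lte_fin => aD; exists ((a + D) / 2); rewrite ?lte_fin; lra.
Qed.

Section boundary_distance.
Context {R : realType} {n : nat}.
Implicit Types (Omega K : set 'rV[R]_n.+1) (x y xi : 'rV[R]_n.+1).

Lemma le_ediam (A : set 'rV[R]_n.+1) x y : A x -> A y ->
  ((enorm (x - y))%:E <= ediam A)%E.
Proof.
move=> Ax Ay; rewrite le_max; apply/orP; right.
by apply: ereal_sup_ubound; exists x => //; exists y.
Qed.

Section fixed_domain.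
Variable Omega : set 'rV[R]_n.+1.
Hypothesis oO : open Omega.
Hypothesis bO : bounded_set Omega \/ ~ bounded_set (bdry Omega).

Lemma bdry_neq0 : Omega !=set0 -> bdry Omega !=set0.
Proof.
move=> [x Ox]; case: bO => [bO'|ubO].
  have xN : x <> x + const_mx 1.
    move=> /esym/eqP; rewrite -subr_eq0 addrAC subrr add0r => /eqP/rowP/(_ ord0)/eqP.
    by rewrite !mxE oner_eq0.
  by have [y byy _] := bounded_open_far_boundary oO bO' Ox xN; exists y.
apply/set0P/negP => /eqP b0; apply: ubO; rewrite b0.
by exists 0; split => // r _ y.
Qed.

(** In a bounded domain, [bounded_open_far_boundary] provides a boundary point
    farther from [xi] than [x] is; otherwise the boundary is unbounded and its
    diameter is infinite. *)
Lemma enorm_lt_ediam x xi : Omega x -> bdry Omega xi ->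
  ((enorm (x - xi))%:E < ediam (bdry Omega))%E.
Proof.
move=> Ox bxi; have xxi : x <> xi by move=> xE; apply: bdryNopen bxi _; rewrite -?xE.
case: bO => [bO'|ubO].
  have [y byy xy] := bounded_open_far_boundary oO bO' Ox xxi.
  by apply: lt_le_trans (le_ediam byy bxi); rewrite lte_fin.
rewrite ltNge; apply/negP => diam_le; apply: ubO.
exists (enorm (x - xi) + `|xi|); split; first exact: num_real.
move=> r /ltW xr y /= byy; apply: le_trans xr.
rewrite -[y](subrK xi) (le_trans (ler_normD _ _))// lerD2r.
apply: (le_trans (norm_le_enorm _)); rewrite -lee_fin.
exact: le_trans (le_ediam byy bxi) diam_le.
Qed.

(** The strict inequality of [enorm_lt_ediam] survives taking the maximum over a
    compact set. *)
Lemma compact_in_boundary_ball K xi : Omega !=set0 -> compact K -> K `<=` Omega ->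
  bdry Omega xi ->
  exists2 r, K `<=` eball xi r & (r%:E < ediam (bdry Omega))%E.
Proof.
move=> [x Ox] cK KO bxi; have [K0|/set0P/negP/negPn/eqP ->] := pselect (K !=set0); last first.
  by exists (enorm (x - xi)); [|exact: enorm_lt_ediam].
have [|c] := compact_EVT_max (f := fun y => enorm (y - xi)) K0 cK.
  by apply: continuous_subspaceT; exact: enormB_continuous.
move=> /set_mem Kc cmax.
have [r cr rD] := exists_fin_between (enorm_lt_ediam (KO _ Kc) bxi).
exists r => // y Ky; rewrite /eball/= enormB.
by apply: le_lt_trans cr; apply: cmax; exact: mem_set.
Qed.

Hypothesis b0 : bdry Omega !=set0.

Let dist_has_inf x : has_inf [set enorm (x - y) | y in bdry Omega].
Proof.
split; first by case: b0 => y byy; exists (enorm (x - y)), y.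
by exists 0 => _ [y _ <-]; exact: enorm_ge0.
Qed.

Lemma delta_le x xi : bdry Omega xi -> delta Omega x <= enorm (x - xi).
Proof. by move=> bxi; apply: ge_inf; [case: (dist_has_inf x)|exists xi]. Qed.

Lemma delta_approx x e : 0 < e ->
  exists2 xi, bdry Omega xi & enorm (x - xi) < delta Omega x + e.
Proof.
move=> e0; have [_ [xi bxi <-] h] := inf_adherent e0 (dist_has_inf x).
by exists xi.
Qed.

Lemma delta_lip x y : delta Omega x <= delta Omega y + enorm (x - y).
Proof.
apply/ler_addgt0Pr => e e0; have [xi bxi yxi] := delta_approx y e0.
have := delta_le x bxi; have := enorm_triangle y x xi; lra.
Qed.

Lemma delta_gt0 x : Omega x -> 0 < delta Omega x.
Proof.
move=> Ox; have [s s0 sO] := eball_in_open oO Ox; apply: (lt_le_trans s0).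
apply: lb_le_inf; first by case: (dist_has_inf x).
move=> _ [y byy <-]; rewrite leNgt; apply/negP => xy.
by apply: bdryNopen byy _; [|exact: sO].
Qed.

Lemma finite_delta_cover K (e : R) : 0 < e -> compact K -> K `<=` Omega ->
  exists N (y : nat -> 'rV[R]_n.+1), (forall i, (i < N)%N -> K (y i)) /\
    K `<=` \bigcup_(i < N) eball (y i) (e * delta Omega (y i)).
Proof.
move=> e0; rewrite compact_cover => cK KO.
have [||s sK Ks] := cK _ K (fun y => eball y (e * delta Omega y)).
- by move=> y _; exact: open_eball.
- by move=> y Ky; exists y => //; apply: eball_center; rewrite mulr_gt0// delta_gt0//; exact: KO.
exists (size (finmap.enum_fset s)), (nth 0 (finmap.enum_fset s)); split => [i si|x /Ks[y /= ys xy]].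
  by apply/set_mem/sK/mem_nth.
by exists (index y (finmap.enum_fset s)); rewrite /= ?index_mem ?nth_index.
Qed.

End fixed_domain.
End boundary_distance.

(** * Measurability of open sets *)

Section open_measurable.
Context {R : realType} {d : nat}.
Implicit Types (x : 'rV[R]_d.+1).

Definition rat_box (ab : 'rV[rat]_d.+1 * 'rV[rat]_d.+1) : set 'rV[R]_d.+1 :=
  [set x | forall i, ratr (ab.1 ord0 i) < x ord0 i < ratr (ab.2 ord0 i)].

Lemma open_rat_boxes (U : set 'rV[R]_d.+1) x : open U -> U x ->
  exists2 ab, rat_box ab `<=` U & rat_box ab x.
Proof.
rewrite openE => /(_ x)/[apply] /nbhs_ballP[e /= e0 eU].
have /choice[a ha] (i : 'I_d.+1) :
    exists q : rat, x ord0 i - e < ratr q < x ord0 i.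
  have [|q] := @rat_in_itvoo R (x ord0 i - e) (x ord0 i); first by lra.
  by rewrite in_itv => /=; exists q.
have /choice[b hb] (i : 'I_d.+1) :
    exists q : rat, x ord0 i < ratr q < x ord0 i + e.
  have [|q] := @rat_in_itvoo R (x ord0 i) (x ord0 i + e); first by lra.
  by rewrite in_itv => /=; exists q.
exists (\row_i a i, \row_i b i) => [y yab|i] /=; last first.
  by have := ha i; have := hb i; rewrite !mxE; lra.
apply: eU; split => // i j; rewrite ord1 /ball/=.
have := yab j; have := ha j; have := hb j; rewrite /= !mxE ltr_norml; lra.
Qed.

(** Half-spaces generate the open sets: they yield rational boxes, and an open set
    is a countable union of these. *)
Lemma open_caratheodory (mu : {outer_measure set 'rV[R]_d.+1 -> \bar R}) :
  (forall i c, mu.-caratheodory [set x | c < x ord0 i]) ->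
  forall U : set 'rV[R]_d.+1, open U -> mu.-caratheodory U.
Proof.
move=> half U oU.
have mhalf i (c : R) : mu.-caratheodory [set x : 'rV[R]_d.+1 | x ord0 i < c].
  have -> : [set x : 'rV[R]_d.+1 | x ord0 i < c] =
      \bigcup_k ~` [set x | c - k.+1%:R^-1 < x ord0 i].
    apply/seteqP; split => x /=.
      move=> xc; have [k ck] := ltr_add_invr xc.
      by exists k => //=; apply/negP; rewrite -leNgt lerBrDr ltW.
    move=> [k _] /= /negP; rewrite -leNgt => /le_lt_trans; apply.
    by rewrite ltrBlDr ltrDl invr_gt0.
  apply: caratheodory_measurable_bigcup => k.
  by apply: caratheodory_measurable_setC; exact: half.
have mbox ab : mu.-caratheodory (rat_box ab).
  have -> : rat_box ab =
      \bigcap_(i in [set: 'I_d.+1]) ([set x | ratr (ab.1 ord0 i) < x ord0 i] `&`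
                   [set x | x ord0 i < ratr (ab.2 ord0 i)]).
    apply/seteqP; split => x /= xab i //.
      by move=> _; have /andP[] := xab i.
    by apply/andP; have := xab i I.
  apply: (@fin_bigcap_measurable _ (caratheodory_type mu)); first exact: finite_finset.
  by move=> i _; apply: caratheodory_measurable_setI; [exact: half|exact: mhalf].
pose F k := if unpickle k is Some ab then
  if `[< rat_box ab `<=` U >] then rat_box ab else set0 else set0.
have -> : U = \bigcup_k F k.
  apply/seteqP; split => [x Ux|x [k _]].
    have [ab abU abx] := open_rat_boxes oU Ux.
    exists (pickle ab) => //; rewrite /F pickleK.
    by case: asboolP.
  rewrite /F; case: unpickle => // ab; case: asboolP => // abU abx.
  exact: abU.
apply: caratheodory_measurable_bigcup => k.
rewrite /F; case: unpickle => [ab|]; last exact: caratheodory_measurable_set0.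
case: asboolP => _; [exact: mbox|exact: caratheodory_measurable_set0].
Qed.

End open_measurable.

Section cover_splitting.
Context {R : realType} {T I : Type}.
Variables (P : set I) (B : I -> set T) (w : I -> \bar R).
Local Open Scope ereal_scope.
Hypothesis w_ge0 : forall i, P i -> 0 <= w i.

(** Common form of two measurability arguments: if every covering set can be
    replaced by one set for [Y] and one for [Z] without increasing the weight,
    then the outer measure is superadditive across [Y] and [Z]. *)
Lemma cover_outer_split (Y Z : set T) :
  (forall i, P i -> exists j, exists k, [/\ P j, P k, B i `&` Y `<=` B j,
     B i `&` Z `<=` B k & w j + w k <= w i]) ->
  forall X, cover_outer P B w (X `&` Y) + cover_outer P B w (X `&` Z) <=
    cover_outer P B w X.
Proof.
move=> split X; apply: le_ereal_inf_tmp => _ [i [Pi Xi] <-].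
have /choice[j /choice[k jk]] n : exists j, exists k, [/\ P j, P k,
  B (i n) `&` Y `<=` B j, B (i n) `&` Z `<=` B k & w j + w k <= w (i n)].
  exact: split.
apply: (@le_trans _ _ (\sum_(n <oo) w (j n) + \sum_(n <oo) w (k n))).
  apply: leeD; apply: ereal_inf_lbound.
  - exists j => //; split => [n|x [/Xi[n _ Bx] Yx]]; first by have [] := jk n.
    by exists n => //; have [_ _ + _ _] := jk n; apply.
  - exists k => //; split => [n|x [/Xi[n _ Bx] Yx]]; first by have [] := jk n.
    by exists n => //; have [_ _ _ + _] := jk n; apply.
rewrite -nneseriesD; last 2 first.
- by move=> n _ _; apply: w_ge0; have [] := jk n.
- by move=> n _ _; apply: w_ge0; have [] := jk n.
apply: lee_nneseries => [n _ _|n _]; last by have [] := jk n.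
by apply: adde_ge0; apply: w_ge0; have [] := jk n.
Qed.

End cover_splitting.

Section lebesgue_measurable.
Context {R : realType} {d : nat}.

Lemma box_split (a b : 'rV[R]_d.+1) (i : 'I_d.+1) (c : R) :
  box_proper (a, b) ->
  exists m : R, let lo := (a, \row_j (if j == i then m else b ord0 j)) in
    let hi := (\row_j (if j == i then m else a ord0 j), b) in
  [/\ box_proper hi, box_proper lo,
      box (a, b) `&` [set x | c < x ord0 i] `<=` box hi,
      box (a, b) `&` ~` [set x | c < x ord0 i] `<=` box lo &
      (box_vol hi + box_vol lo <= box_vol (a, b))%E].
Proof.
move=> ab; have /= abi := ab i.
pose m := Num.max (a ord0 i) (Num.min c (b ord0 i)).
have am : a ord0 i <= m by rewrite le_max lexx.
have mb : m <= b ord0 i by rewrite ge_max abi ge_min lexx orbT.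
(* the cutting level c is clamped to the side of the box, so that one of the two
   halves may be degenerate *)
exists m => /=; split.
- by move=> j /=; rewrite mxE; case: eqP => [->|_] //; exact: ab.
- by move=> j /=; rewrite mxE; case: eqP => [->|_] //; exact: ab.
- move=> x [xab /= cx] j /=; have /= /andP[ax xb] := xab j.
  rewrite xb andbT mxE; case: eqP => [ji|//]; rewrite ji in ax *.
  by rewrite gt_max ax gt_min cx.
- move=> x [xab /= /negP]; rewrite -leNgt => cx j /=; have /= /andP[ax xb] := xab j.
  rewrite ax/= mxE; case: eqP => [ji|//]; rewrite ji in xb *.
  by rewrite le_max le_min cx xb orbT.
- rewrite /box_vol -EFinD lee_fin.
  rewrite (bigD1 i)//= [X in _ + X <= _](bigD1 i)//= [leRHS](bigD1 i)//= !mxE eqxx.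
  rewrite (eq_bigr (fun j => b ord0 j - a ord0 j)); last first.
    by move=> j /negbTE ji; rewrite mxE ji.
  rewrite [in X in _ + X <= _](eq_bigr (fun j => b ord0 j - a ord0 j)); last first.
    by move=> j /negbTE ji; rewrite mxE ji.
  by rewrite -mulrDl addrA subrK.
Qed.

Lemma open_leb_measurable (U : set 'rV[R]_d.+1) :
  open U -> leb_outer.-cara.-measurable U.
Proof.
apply: open_caratheodory => i c; apply: le_caratheodory_measurable => X.
apply: cover_outer_split => [ab|[a b]]; first exact: box_vol_ge0.
move=> /(box_split i c)[m [Phi Plo Bhi Blo vol]].
by eexists; eexists; split; [exact: Phi|exact: Plo|exact: Bhi|exact: Blo|].
Qed.

Lemma compact_leb_measurable (K : set 'rV[R]_d.+1) : compact K ->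
  leb_outer.-cara.-measurable K.
Proof.
move=> cK; rewrite -(setCK K); apply: measurableC; apply: open_leb_measurable.
by apply: closed_openC; apply: compact_closed cK; exact: norm_hausdorff.
Qed.

End lebesgue_measurable.

Section separated_halfspaces.
Context {R : realType} {d : nat}.
Variable mu : {outer_measure set 'rV[R]_d.+1 -> \bar R}.
Variable i : 'I_d.+1.
Implicit Types (X : set 'rV[R]_d.+1) (s t c : R).
Local Open Scope ereal_scope.

Let below s := [set x : 'rV[R]_d.+1 | (x ord0 i <= s)%R].
Let above t := [set x : 'rV[R]_d.+1 | (t <= x ord0 i)%R].

Hypothesis mu_separated : forall X s t, (s < t)%R ->
  mu (X `&` above t) + mu (X `&` below s) <= mu X.

(** Every other slab of a decreasing sequence of levels is separated from the
    next one kept, so additivity across a gap sums their measures. *)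
Lemma sum_alternate_slabs X (u : nat -> R) N :
  (forall j k, (j < k)%N -> (u k < u j)%R) ->
  \sum_(j < N) mu (X `&` above (u (j.*2.+2)) `&` below (u (j.*2.+1))) <=
    mu (X `&` above (u N.*2)).
Proof.
move=> udec; elim: N => [|N IH]; first by rewrite big_ord0 outer_measure_ge0.
rewrite big_ord_recr/=; apply: le_trans (mu_separated (s := u N.*2.+1) _ (udec N.*2 _ _)) => //.
apply: leeD; last by [].
apply: (le_trans IH); apply: le_outer_measure => x [Xx ux]; split => //; split => //.
by apply: le_trans ux; apply/ltW/udec; rewrite doubleS ltnW.
Qed.

(** Caratheodory's criterion: the part of [X] above a level decreasing to [c] is
    separated from the part below [c], and what is missing is covered by slabs
    whose total measure is the tail of a convergent series, because the slabs of
    even index and those of odd index each sum to at most [mu X]. *)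
Lemma halfspace_caratheodory c : mu.-caratheodory [set x | (c < x ord0 i)%R].
Proof.
apply: le_caratheodory_measurable => X.
have [->|Xfin] := eqVneq (mu X) +oo; first exact: leey.
pose u k : R := (c + k.+1%:R^-1)%R.
have udec j k : (j < k)%N -> (u k < u j)%R.
  by move=> jk; rewrite ltrD2l ltf_pV2 ?posrE// ltr_nat.
have ule j k : (j <= k)%N -> (u k <= u j)%R.
  by rewrite leq_eqVlt => /predU1P[->//|/udec/ltW].
pose slab k := X `&` above (u k.+1) `&` below (u k).
pose f k := mu (slab k.*2.+1) + mu (slab k.*2.+2).
have f0 k : 0 <= f k by rewrite adde_ge0// outer_measure_ge0.
have foo : \sum_(0 <= k <oo) f k < +oo.
  apply: (@le_lt_trans _ _ (mu X + mu X)); last first.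
    by rewrite lte_add_pinfty// ltey.
  apply: lime_le; first by apply: is_cvg_nneseries => n _ _; exact: f0.
  apply: nearW => N; rewrite big_mkord big_split/=; apply: leeD.
    apply: le_trans (sum_alternate_slabs X N udec) _.
    by apply: le_outer_measure => x [].
  have udecS j k : (j < k)%N -> (u k.+1 < u j.+1)%R by move=> jk; exact: udec.
  apply: le_trans (sum_alternate_slabs X N udecS) _.
  by apply: le_outer_measure => x [].
have /(_ foo (fun k _ => f0 k)) tail := @nneseries_tail_cvg _ f xpredT.
have -> : ~` [set x : 'rV[R]_d.+1 | (c < x ord0 i)%R] = below c.
  by apply/seteqP; split => x; rewrite /below/= leNgt => /negP.
have cover k : mu (X `&` [set x | (c < x ord0 i)%R]) <=
    mu (X `&` above (u k.*2.+1)) + \sum_(k <= j <oo) f j.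
  pose A j := slab (j + k).*2.+1 `|` slab (j + k).*2.+2.
  apply: (@le_trans _ _ (mu ((X `&` above (u k.*2.+1)) `|` \bigcup_j A j))).
    apply: le_outer_measure => x [Xx cx].
    have [|ux] := leP (u k.*2.+1) (x ord0 i); first by left.
    right; have [m um] : exists m, (u m <= x ord0 i)%R.
      by have [m um] := ltr_add_invr cx; exists m; exact: ltW.
    (* x lies in the pair of slabs just above the first level u_(2j+1) not
       exceeding its coordinate *)
    have exj : exists j, (u j.*2.+1 <= x ord0 i)%R.
      by exists m; apply: le_trans um; apply/ltW/udec; rewrite ltnS -addnn leq_addr.
    have := ex_minnP exj; case=> -[|j] uj jmin.
      by move: (lt_le_trans ux (ule 1%N k.*2.+1 isT)); rewrite ltNge uj.
    have kj : (k <= j)%N.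
      rewrite leqNgt; apply/negP => jk.
      have : (u k.*2.+1 <= u j.+1.*2.+1)%R by apply: ule; rewrite ltnS leq_double.
      by move=> /le_trans/(_ uj); rewrite leNgt ux.
    have uj' : (x ord0 i < u j.*2.+1)%R.
      by rewrite ltNge; apply/negP => /jmin; rewrite ltnn.
    exists (j - k)%N => //; rewrite /A subnK//.
    have [um2|um2] := leP (u j.*2.+2) (x ord0 i).
      by left; split => //=; exact: ltW.
    by right; split => //=; exact: ltW.
  apply: le_trans (outer_measureU2 _ _ _) _; rewrite leeD2l//.
  apply: le_trans (outer_measure_sigma_subadditive mu A) _.
  rewrite -(nneseries_addn k f0); apply: lee_nneseries => [j _ _|j _].
    exact: outer_measure_ge0.
  exact: outer_measureU2.
apply/lee_addgt0Pr => e e0.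
have [k /ltW ke] : exists k, \sum_(k <= j <oo) f j < e%:E.
  have /fine_cvgP[tfin tail0] := tail.
  have /cvgrPdist_lt/(_ _ e0)[k1 _ hk1] := tail0.
  have [k2 _ hk2] := tfin.
  exists (maxn k1 k2); rewrite -(fineK (hk2 _ (leq_maxr _ _))) lte_fin.
  have := hk1 _ (leq_maxl k1 k2); rewrite /= sub0r normrN; exact/le_lt_trans/ler_norm.
apply: le_trans (leeD2r _ (cover k)) _; rewrite addeAC; apply: leeD => //.
by apply: mu_separated; rewrite ltrDl invr_gt0.
Qed.

End separated_halfspaces.

Section hausdorff_measurable.
Context {R : realType} {d : nat}.
Variable m : nat.
Implicit Types (X Y Z : set 'rV[R]_d.+1).
Local Open Scope ereal_scope.

Lemma le_hausdorff_delta (e e' : R) X : (e' <= e)%R ->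
  hausdorff_delta m e X <= hausdorff_delta m e' X.
Proof.
move=> ee; apply/ereal_inf_le_tmp => _ [U [Ue XU] <-]; exists U => //; split => //.
by move=> k; apply: (le_trans (Ue k)); rewrite lee_fin.
Qed.

Lemma ediam_coord (U : set 'rV[R]_d.+1) (x y : 'rV[R]_d.+1) i :
  U x -> U y -> (x ord0 i - y ord0 i)%:E <= ediam U.
Proof.
move=> Ux Uy; apply: le_trans (le_ediam Ux Uy); rewrite lee_fin (le_trans (ler_norm _))//.
by have := coord_le_enorm (x - y) i; rewrite !mxE.
Qed.

(** Two sets whose [i]-th coordinates are more than [e] apart cannot both be met
    by a set of diameter at most [e], so every cover used to compute
    [hausdorff_delta m e] splits into two disjoint covers. *)
Lemma hausdorff_delta_separated (i : 'I_d.+1) X s t (e : R) :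
  (0 < e)%R -> (e < t - s)%R ->
  hausdorff_delta m e (X `&` [set x | (t <= x ord0 i)%R]) +
  hausdorff_delta m e (X `&` [set x | (x ord0 i <= s)%R]) <=
  hausdorff_delta m e X.
Proof.
move=> e0 ets; apply: cover_outer_split => [U _|U Ue].
  exact: hausdorff_weight_ge0.
have w0 : hausdorff_weight m (set0 : set 'rV[R]_d.+1) = 0.
  by rewrite /hausdorff_weight asboolT.
have d0 : [set V : set 'rV[R]_d.+1 | ediam V <= e%:E] set0.
  rewrite /ediam /= (_ : [set _ | _ in _ & _ in _] = set0) ?ereal_sup0.
    by rewrite maxeNy lee_fin ltW.
  by rewrite predeqE => z; split => // -[? []].
have [[x [Ux /= tx]]|/set0P/negP/negPn/eqP UY] :=
    pselect ((U `&` [set x | (t <= x ord0 i)%R]) !=set0).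
  exists U, set0; split => //; last by rewrite w0 adde0.
  move=> y [Uy /= ys]; have := le_trans (ediam_coord i Ux Uy) Ue.
  by rewrite lee_fin => ?; exfalso; lra.
by exists set0, U; split => //; [rewrite UY|rewrite w0 add0e].
Qed.

Lemma hausdorff_separated (i : 'I_d.+1) X (s t : R) : (s < t)%R ->
  hausdorff m (X `&` [set x | (t <= x ord0 i)%R]) +
  hausdorff m (X `&` [set x | (x ord0 i <= s)%R]) <= hausdorff m X.
Proof.
move=> st; set Y := X `&` _; set Z := X `&` _.
have [->|Xfin] := eqVneq (hausdorff m X) +oo; first exact: leey.
have Ffin W : W `<=` X -> hausdorff m W \is a fin_num.
  move=> /(le_hausdorff m) WX.
  by rewrite ge0_fin_numE ?hausdorff_ge0// (le_lt_trans WX)// ltey.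
have key (e1 e2 : R) : (0 < e1)%R -> (0 < e2)%R ->
    hausdorff_delta m e1 Y + hausdorff_delta m e2 Z <= hausdorff m X.
  move=> e1_gt0 e2_gt0; pose e := Num.min (Num.min e1 e2) ((t - s) / 2)%R.
  have e0 : (0 < e)%R by rewrite !lt_min e1_gt0 e2_gt0/=; lra.
  have ets : (e < t - s)%R.
    by apply: (@le_lt_trans _ _ ((t - s) / 2)%R); [rewrite ge_min lexx orbT|lra].
  apply: le_trans (ereal_sup_ubound _); last by exists e.
  apply: le_trans (hausdorff_delta_separated i X e0 ets).
  by apply: leeD; apply: le_hausdorff_delta; rewrite !ge_min lexx ?orbT.
have HY : hausdorff m Y \is a fin_num by apply: Ffin => x [].
have HZ : hausdorff m Z \is a fin_num by apply: Ffin => x [].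
rewrite -leeBrDr//; apply: ge_ereal_sup => _ [e1 /= e1_gt0 <-].
rewrite leeBrDr// addeC.
have D1 : hausdorff_delta m e1 Y \is a fin_num.
  rewrite ge0_fin_numE ?hausdorff_delta_ge0//.
  apply: (@le_lt_trans _ _ (hausdorff m Y)); last by rewrite ltey_eq HY.
  by apply: ereal_sup_ubound; exists e1.
rewrite -leeBrDr//; apply: ge_ereal_sup => _ [e2 /= e2_gt0 <-].
by rewrite leeBrDr// addeC key.
Qed.

Lemma open_hausdorff_caratheodory (U : set 'rV[R]_d.+1) :
  open U -> (hausdorff m).-caratheodory U.
Proof.
apply: open_caratheodory => i c; apply: halfspace_caratheodory => X s t.
exact: hausdorff_separated.
Qed.

End hausdorff_measurable.

Lemma open_sigma_caratheodory (R : realType) (n : nat) (Omega : set 'rV[R]_n.+1)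
  (U : set 'rV[R]_n.+1) : open U -> (sigma_outer Omega).-caratheodory U.
Proof.
move=> oU X; rewrite /sigma_outer (setIAC X U) (setIAC X (~` U)).
exact: (open_hausdorff_caratheodory n oU).
Qed.

Lemma open_sigma_measurable (R : realType) (n : nat) (Omega : set 'rV[R]_n.+1)
  (U : set 'rV[R]_n.+1) : open U -> (sigma_outer Omega).-cara.-measurable U.
Proof. exact: open_sigma_caratheodory. Qed.

(** * Greedy selection and geometric sums *)

Section greedy_selection.
Context {R : realType} {I : finType}.

(** The finite Vitali selection: pick an element of largest radius, make it the
    leader of everything related to it, and start again on the rest. *)
Lemma greedy_selection (e : rel I) (rho : I -> R) :
  reflexive e -> symmetric e ->
  exists l : I -> I, [/\ forall i, l (l i) = l i, forall i, e (l i) i,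
    forall i, rho i <= rho (l i) &
    forall i j, e (l i) (l j) -> l i = l j].
Proof.
move=> erefl esym.
suff Hl : forall A : {set I}, exists l : I -> I,
    (forall i, i \in A -> [/\ l i \in A, l (l i) = l i, e (l i) i &
      rho i <= rho (l i)]) /\
    (forall i j, i \in A -> j \in A -> e (l i) (l j) -> l i = l j).
  have [l [h1 h2]] := Hl [set: I]%SET.
  exists l; split => [i|i|i|i j]; try by have [] := h1 i (finset.in_setT i).
  by apply: h2; rewrite finset.in_setT.
move=> A; have [n] := ubnP #|A|; elim: n A => // n IH A /ltnSE An.
have [->|[i0 Ai0]] := set_0Vmem A.
  by exists id; split => [i|i j]; rewrite !inE.
pose a := [arg max_(i > i0 in A) rho i]%O.
have [aA amax] : a \in A /\ forall j, j \in A -> rho j <= rho a.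
  by rewrite /a; case: arg_maxP.
have [|l [h1 h2]] := IH (A :\: [set i | e a i])%SET.
  apply: leq_trans An; apply: proper_card; apply/properP; split.
    exact: subsetDl.
  by exists a => //; rewrite !inE erefl.
have inA' i : i \in A -> ~~ e a i -> i \in (A :\: [set i | e a i])%SET.
  by rewrite !inE => -> ->.
exists (fun i => if e a i then a else l i); split => [i iA|i j iA jA].
  case: ifPn => [ai|/(inA' _ iA)/h1[]]; first by rewrite erefl; split => //; exact: amax.
  by rewrite !inE => /andP[/negbTE -> lA] -> ? ?.
case: ifPn => [ai|/(inA' _ iA) iA']; case: ifPn => [aj|/(inA' _ jA) jA'] //.
- by have [] := h1 _ jA'; rewrite !inE => /andP[/negbTE ->].
- by have [] := h1 _ iA'; rewrite !inE esym => /andP[/negbTE ->].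
- exact: h2.
Qed.

(** Distinct powers of 2 add up to less than twice the largest of them. *)
Lemma sum_pow2_inj (A : {pred I}) (k : I -> nat) (x : R) : 0 <= x ->
  {in A &, injective k} ->
  (forall i, i \in A -> 2 ^+ k i <= x) ->
  \sum_(i in A) 2 ^+ k i <= 2 * x :> R.
Proof.
move=> x0 kinj kx.
have [[i0 Ai0]|A0] := pselect (exists i, i \in A); last first.
  rewrite big_pred0 ?mulr_ge0// => i; apply/negP => iA.
  by apply: A0; exists i.
pose m := [arg max_(i > i0 in A) k i].
have [mA mmax] : m \in A /\ forall j, j \in A -> (k j <= k m)%N.
  by rewrite /m; case: arg_maxnP.
apply: (@le_trans _ _ (2 ^+ (k m).+1)); last first.
  by rewrite exprS ler_pM2l// kx.
have -> : \sum_(i in A) 2 ^+ k i = (\sum_(i in A) 2 ^ k i)%N%:R :> R.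
  by rewrite natr_sum; apply: eq_bigr => i _; rewrite natrX.
rewrite -natrX ler_nat.
pose h (i : I) : 'I_(k m).+1 := inord (k i).
have hE i : i \in A -> h i = k i :> nat by move=> /mmax ik; rewrite inordK// ltnS.
have hinj : {in A &, injective h}.
  by move=> i j iA jA /(congr1 val) /=; rewrite !hE//; exact: kinj.
have -> : (\sum_(i in A) 2 ^ k i = \sum_(j in h @: A) 2 ^ j)%N.
  by rewrite big_imset//=; apply: eq_bigr => i iA; rewrite hE.
apply: (@leq_trans (\sum_(j < (k m).+1) 2 ^ j)%N).
  by rewrite [leqRHS](bigID [in h @: A])/= leq_addr.
by rewrite -[leqRHS]prednK ?expn_gt0// predn_exp mul1n leqnSn.
Qed.

End greedy_selection.

(** * Decomposition of a finite family of weighted sets *)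

Section discrete_square_function.
Context {d : measure_display} {T : measurableType d} {R : realType}.
Variable mu : {measure set T -> \bar R}.
Context {I : finType}.
Variables (b : I -> set T) (v w : I -> R) (p : R).
Hypothesis mb : forall i, measurable (b i).
Hypothesis bv : forall i, mu (b i) = (v i)%:E.
Hypothesis v_gt0 : forall i, 0 < v i.
Hypothesis w_gt0 : forall i, 0 < w i.
Hypothesis p_gt0 : 0 < p.
Hypothesis p_le1 : p <= 1.

(** The discrete counterpart of the square of the area function, for sets [b i]
    of measure [v i] carrying the masses [w i]. *)
Definition dsq (x : T) : R := \sum_i w i / v i * \1_(b i) x.

Let E (t : R) : set T := [set x | t < dsq x `^ (p / 2)].

Let p2_gt0 : 0 < p / 2. Proof. by rewrite divr_gt0. Qed.

Lemma dsq_term_ge0 i x : 0 <= w i / v i * \1_(b i) x.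
Proof. by rewrite mulr_ge0// divr_ge0// ltW. Qed.

Lemma dsq_ge0 x : 0 <= dsq x.
Proof. by apply: sumr_ge0 => i _; exact: dsq_term_ge0. Qed.

Lemma measurable_dsq : measurable_fun setT dsq.
Proof.
apply: measurable_sum => i.
by apply: measurable_funM; [exact: measurable_cst|exact: measurable_indic].
Qed.

Lemma measurable_dsq_powR : measurable_fun setT (fun x => dsq x `^ (p / 2)).
Proof. exact: (measurableT_comp (measurable_powR _) measurable_dsq). Qed.

Let mE t : measurable (E t).
Proof.
rewrite [E t](_ : _ = setT `&` (fun x => dsq x `^ (p / 2)) @^-1` `]t, +oo[%classic).
  by apply: measurable_dsq_powR.
by rewrite setTI; apply/seteqP; split => x; rewrite /E/= in_itv/= andbT.
Qed.


(** [theta] is so small that every [b i] is contained in the first superlevel set,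
    and the superlevel sets are eventually empty; [k i] is the last level before
    less than half of [b i] remains. *)
Lemma stopping_levels : exists theta (k : I -> nat), [/\ 0 < theta,
  forall i, ((v i / 2)%:E <= mu (b i `&` E (theta * 2 ^+ k i)))%E &
  forall i, ((v i / 2)%:E <= mu (b i `&` ~` E (theta * 2 ^+ (k i).+1)))%E].
Proof.
(* on b i the i-th term alone makes dsq x `^ (p / 2) at least c, hence larger than
   theta = c / 2 *)
pose c := \big[Num.min/1]_i ((w i / v i) `^ (p / 2)).
have c0 : 0 < c.
  by apply: lt_bigmin => // i _; rewrite powR_gt0// divr_gt0.
pose theta := c / 2.
have theta0 : 0 < theta by rewrite divr_gt0.
have E0 i : b i `<=` E theta.
  move=> x bx; rewrite /E/=; apply: (@lt_le_trans _ _ ((w i / v i) `^ (p / 2))).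
    apply: (@lt_le_trans _ _ c); first by rewrite /theta; lra.
    exact: bigmin_le_cond.
  have : w i / v i <= dsq x.
    rewrite /dsq (bigD1 i)//= indicE mem_set// mulr1 lerDl.
    by apply: sumr_ge0 => j _; exact: dsq_term_ge0.
  apply: ge0_ler_powR; rewrite ?nnegrE ?dsq_ge0 ?divr_ge0// ltW//.
have bfin i A : measurable A -> mu (b i `&` A) \is a fin_num.
  move=> mA; rewrite ge0_fin_numE// (@le_lt_trans _ _ (mu (b i)))//.
    by apply: le_measure; rewrite ?inE//; exact: measurableI.
  by rewrite bv ltry.
have bsplit i A : measurable A ->
    (v i)%:E = (mu (b i `&` A) + mu (b i `&` ~` A))%E.
  by move=> mA; rewrite -bv [LHS](measureDI _ (mb i) mA) setDE addeC.
have [K EK] : exists K, forall k, (K <= k)%N -> E (theta * 2 ^+ k) = set0.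
  pose M := (\sum_i w i / v i) `^ (p / 2).
  have [K MK] : exists K, M / theta < 2 ^+ K :> R.
    exists (Num.truncn (M / theta)).+1.
    apply: (lt_le_trans (truncnS_gt _)); rewrite -natrX ler_nat.
    exact/ltnW/ltn_expl.
  exists K => k Kk; apply/seteqP; split => // x; rewrite /E/=; apply/negP.
  rewrite -leNgt; apply: (@le_trans _ _ M).
    have h : dsq x <= \sum_i w i / v i.
      apply: ler_sum => i _; rewrite -[leRHS]mulr1 ler_wpM2l//.
        by rewrite divr_ge0// ltW.
    by apply: ge0_ler_powR; rewrite ?nnegrE ?dsq_ge0 ?(le_trans (dsq_ge0 x) h)// ltW.
  rewrite -ler_pdivrMl// mulrC; apply: (le_trans (ltW MK)).
  by rewrite ler_weXn2l ?ler1n.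
pose P i k := (mu (b i `&` E (theta * 2 ^+ k.+1)) < (v i / 2)%:E)%E.
have exP i : exists k, P i k.
  exists K; rewrite /P EK ?leqnSn// setI0 measure0 lte_fin divr_gt0//.
exists theta, (fun i => ex_minn (exP i)); split => // i.
  case: ex_minnP => -[|k] Pk kmin.
    rewrite expr0 mulr1 setIidl; last exact: E0.
    by rewrite bv lee_fin; have := v_gt0 i; lra.
  by rewrite leNgt; apply/negP => /kmin; rewrite ltnn.
case: ex_minnP => k Pk _; rewrite leNgt; apply/negP => h.
have := lteD Pk h; rewrite -bsplit// -EFinD lte_fin; lra.
Qed.


(** Since half of [b j] lies where [dsq x `^ (p / 2) <= t], the mass [w j] is at most
    twice the integral of its own term of [dsq] over that region; summing over a
    group contained in [B] leaves the integral of [dsq] over a part of [B] where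
    it is at most [t `^ (2 / p)]. *)
Lemma group_weight_le (J : {pred I}) (B : set T) (V t : R) :
  measurable B -> mu B = V%:E -> 0 <= t -> (forall j, j \in J -> b j `<=` B) ->
  (forall j, j \in J -> ((v j / 2)%:E <= mu (b j `&` ~` E t))%E) ->
  \sum_(j in J) w j <= 2 * t `^ (2 / p) * V.
Proof.
move=> mB BV t0 bB vt; pose D := B `&` ~` E t.
have mD : measurable D by apply: measurableI => //; apply: measurableC; exact: mE.
rewrite -lee_fin -sumEFin.
apply: (@le_trans _ _ (\sum_(j in J) 2%:E * \int[mu]_(x in D)
    (w j / v j * \1_(b j) x)%:E)%E).
  apply: lee_sum => j jJ.
  under eq_integral do rewrite EFinM.
  rewrite ge0_integralZl_EFin//; last 2 first.
    by apply/measurable_EFinP; exact: measurable_indic.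
    by rewrite divr_ge0// ltW.
  rewrite integral_indic// (_ : b j `&` D = b j `&` ~` E t); last first.
    by rewrite setIA; congr (_ `&` _); exact/setIidl/bB.
  apply: (@le_trans _ _ (2%:E * ((w j / v j)%:E * (v j / 2)%:E))%E).
    rewrite -!EFinM lee_fin le_eqVlt; apply/orP; left; apply/eqP.
    by field; rewrite ?gt_eqF.
  by rewrite lee_wpmul2l ?lee_fin// lee_wpmul2l ?vt ?lee_fin ?divr_ge0 ?ltW.
rewrite -ge0_sume_distrr; last first.
  by move=> j _; apply: integral_ge0 => x _; rewrite lee_fin dsq_term_ge0.
rewrite -mulrA EFinM lee_wpmul2l ?lee_fin//.
rewrite -[X in (X <= _)%E]big_enum/= -ge0_integral_sum//; last 2 first.
- move=> j; apply/measurable_EFinP.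
  by apply: measurable_funM; [exact: measurable_cst|exact: measurable_indic].
- by move=> j x _; rewrite lee_fin dsq_term_ge0.
apply: (@le_trans _ _ (\int[mu]_(x in D) (t `^ (2 / p))%:E)%E).
  apply: ge0_le_integral => //.
  - by move=> x _; apply: sume_ge0 => j _; rewrite lee_fin dsq_term_ge0.
  - apply: emeasurable_sum => j; apply/measurable_EFinP.
    by apply: measurable_funM; [exact: measurable_cst|exact: measurable_indic].
  move=> x [_ /= /negP]; rewrite -leNgt => St.
  rewrite sumEFin lee_fin big_enum/=; apply: (@le_trans _ _ (dsq x)).
    rewrite /dsq [leRHS](bigID (mem J))/= lerDl.
    by apply: sumr_ge0 => j _; exact: dsq_term_ge0.
  have -> : dsq x = (dsq x `^ (p / 2)) `^ (2 / p).
    rewrite -powRrM (_ : p / 2 * (2 / p) = 1) ?powRr1 ?dsq_ge0//.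
    by field; rewrite gt_eqF.
  apply: ge0_ler_powR; rewrite ?nnegrE ?powR_ge0//.
  by rewrite divr_ge0// ltW.
rewrite integral_cst// EFinM lee_wpmul2l ?lee_fin ?powR_ge0// -BV.
by apply: le_measure; rewrite ?inE//; exact: subIsetl.
Qed.

(** The members of [L] that contribute at [x] meet at [x], so they have distinct
    levels, and the powers [theta * 2 ^+ k i] are below [dsq x `^ (p / 2)]. *)
Lemma stopped_overlap (L : {pred I}) (k : I -> nat) theta (x : T) :
  0 < theta ->
  {in L &, forall i j, k i = k j -> b i `&` b j !=set0 -> i = j} ->
  \sum_(i in L) theta * 2 ^+ k i * \1_(b i `&` E (theta * 2 ^+ k i)) x <=
    2 * dsq x `^ (p / 2).
Proof.
move=> theta0 Linj; pose A := [pred i in L | x \in b i `&` E (theta * 2 ^+ k i)].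
rewrite (eq_bigr (fun i => if i \in A then theta * 2 ^+ k i else 0)); last first.
  by move=> i iL; rewrite inE iL/= indicE; case: ifP => _; rewrite ?mulr1 ?mulr0.
rewrite -big_mkcondr (eq_bigl (mem A)); last first.
  by move=> i; apply/andP/idP => [[]//|iA]; split => //; case/andP: iA.
rewrite -big_distrr/= -ler_pdivlMl// mulrCA; apply: sum_pow2_inj.
- by rewrite mulr_ge0 ?powR_ge0// invr_ge0 ltW.
- move=> i j /andP[iL /set_mem[bi _]] /andP[jL /set_mem[bj _]] kij.
  by apply: Linj => //; exists x.
- move=> i /andP[iL /set_mem[_]]; rewrite /E/= => /ltW.
  by rewrite -ler_pdivlMl.
Qed.

(** The set [B i] stands for the enlargement of the leader [b i], comparable to it
    in measure and containing its whole group. The term of index [i] is the p-th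
    power of the coefficient of the atom built from the group of [i]; it vanishes
    unless [i] is a leader. *)
Lemma discrete_decomposition (rho : I -> R) : exists l : I -> I,
  [/\ forall i, l (l i) = l i, forall i, b (l i) `&` b i !=set0,
    forall i, rho i <= rho (l i) &
    forall (B : I -> set T) (V : I -> R) (M : R),
      (forall i, measurable (B i)) -> 0 <= M -> (forall i, mu (B i) = (V i)%:E) ->
      (forall i, b i `<=` B (l i)) -> (forall i, V i <= M * v i) ->
    ((\sum_i ((\sum_(j | l j == i) w j) * V i `^ (2 / p - 1)) `^ (p / 2))%:E
      <= (16 * M)%:E * \int[mu]_x (dsq x `^ (p / 2))%:E)%E].
Proof.
have [theta [k [theta0 kE kEC]]] := stopping_levels.
pose e := [rel i j | (k i == k j) && `[< b i `&` b j !=set0 >]].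
have [||l [ll el rhol lsep]] := greedy_selection (e := e) rho.
- move=> i; rewrite /e/= eqxx; apply/asboolP/set0P.
  apply/negP => /eqP; rewrite setIid => bi0.
  by have := bv i; rewrite bi0 measure0 => -[v0]; have := v_gt0 i; rewrite -v0 ltxx.
- by move=> i j; rewrite /e/= eq_sym setIC.
exists l; split => // [i|B V M mB M0 BV bB VM].
  by have /andP[_ /asboolP] := el i.
have kl i : k (l i) = k i by have /andP[/eqP] := el i.
pose L := [pred i | l i == i].
have bound i : ((\sum_(j | l j == i) w j) * V i `^ (2 / p - 1)) `^ (p / 2) <=
    if i \in L then 4 * (theta * 2 ^+ k i) * V i else 0.
  rewrite inE; case: ifPn => [/eqP li|lNi]; last first.
    rewrite big_pred0 ?mul0r ?powR0 ?gt_eqF//.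
    by move=> j; apply/negP => /eqP ji; move: lNi; rewrite -ji ll eqxx.
  have [t tE] : {t | t = theta * 2 ^+ (k i).+1} by eexists.
  have t0 : 0 < t by rewrite tE mulr_gt0 ?exprn_gt0.
  have Vi : 0 < V i.
    apply: (lt_le_trans (v_gt0 i)); rewrite -lee_fin -bv -BV.
    by apply: le_measure; rewrite ?inE//; rewrite -[X in B X]li; exact: bB.
  have Wle : \sum_(j | l j == i) w j <= 2 * t `^ (2 / p) * V i.
    apply: (@group_weight_le [pred j | l j == i] (B i)) => //; first exact: ltW.
      by move=> j; rewrite inE => /eqP <-; exact: bB.
    by move=> j; rewrite inE => /eqP ji; rewrite tE -ji kl; exact: kEC.
  have W0 : 0 <= \sum_(j | l j == i) w j by apply: sumr_ge0 => j _; exact: ltW.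
  apply: (@le_trans _ _ ((2 * t `^ (2 / p) * V i `^ (2 / p)) `^ (p / 2))).
    apply: ge0_ler_powR; rewrite ?nnegrE ?mulr_ge0 ?powR_ge0//; first exact: ltW.
    apply: (@le_trans _ _ (2 * t `^ (2 / p) * V i * V i `^ (2 / p - 1))).
      by apply: ler_wpM2r => //; exact: powR_ge0.
    rewrite -!mulrA -{1}(powRr1 (ltW Vi)) -powRD.
      by rewrite addrCA subrr addr0.
    by rewrite (gt_eqF Vi) implybT.
  have p2 : 2 / p * (p / 2) = 1 by field; rewrite gt_eqF.
  rewrite !powRM ?mulr_ge0 ?powR_ge0// -!powRrM p2 !powRr1 ?(ltW t0) ?(ltW Vi)//.
  apply: ler_wpM2r; first exact: ltW.
  have -> : 4 * (theta * 2 ^+ k i) = 2 * t by rewrite tE exprS; ring.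
  apply: ler_wpM2r; first exact: ltW.
  rewrite -[leRHS]powRr1//; apply: ler_powR; last by have := p_le1; lra.
  by lra.
apply: (@le_trans _ _ (\sum_(i in L) (8 * M)%:E *
    \int[mu]_x (theta * 2 ^+ k i * \1_(b i `&` E (theta * 2 ^+ k i)) x)%:E)%E).
  apply: (@le_trans _ _ (\sum_(i in L) (4 * (theta * 2 ^+ k i) * V i)%:E)%E).
    rewrite sumEFin lee_fin [leRHS]big_mkcond; apply: ler_sum => i _; exact: bound.
  apply: lee_sum => i _.
  have th0 : 0 <= theta * 2 ^+ k i by rewrite mulr_ge0// ?exprn_ge0// ltW.
  have mbE : measurable (b i `&` E (theta * 2 ^+ k i)) by apply: measurableI.
  under eq_integral do rewrite EFinM.
  rewrite ge0_integralZl_EFin//; last first.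
    by apply/measurable_EFinP; exact: measurable_indic.
  rewrite integral_indic// setIT.
  apply: (@le_trans _ _ ((8 * M)%:E * ((theta * 2 ^+ k i)%:E * (v i / 2)%:E))%E).
    rewrite -!EFinM lee_fin.
    have -> : 8 * M * (theta * 2 ^+ k i * (v i / 2)) =
      4 * (theta * 2 ^+ k i) * (M * v i) by field.
    by rewrite ler_wpM2l// mulr_ge0.
  by rewrite !lee_wpmul2l// ?lee_fin// mulr_ge0.
rewrite -ge0_sume_distrr; last first.
  by move=> i _; apply: integral_ge0 => x _; rewrite lee_fin !mulr_ge0 ?exprn_ge0// ltW.
have m_term i : measurable_fun setT
    (fun x => (theta * 2 ^+ k i * \1_(b i `&` E (theta * 2 ^+ k i)) x)%:E).
  apply/measurable_EFinP; apply: measurable_funM; first exact: measurable_cst.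
  by apply: measurable_indic; exact: measurableI.
have term_ge0 i x : (0 <= (theta * 2 ^+ k i * \1_(b i `&` E (theta * 2 ^+ k i)) x)%:E)%E.
  by rewrite lee_fin !mulr_ge0 ?exprn_ge0// ltW.
rewrite (_ : 16 * M = 8 * M * 2); last by ring.
rewrite (EFinM (8 * M) 2) -muleA lee_wpmul2l ?lee_fin ?mulr_ge0//.
rewrite -[X in (X <= _)%E]big_enum/= -ge0_integral_sum//.
rewrite -ge0_integralZl_EFin//; last first.
  by apply/measurable_EFinP; exact: measurable_dsq_powR.
  by move=> x _; rewrite lee_fin powR_ge0.
apply: ge0_le_integral => //.
- by move=> x _; apply: sume_ge0.
- by apply: emeasurable_sum.
- by apply/measurable_EFinP; apply: measurable_funM => //; exact: measurable_dsq_powR.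
move=> x _; rewrite sumEFin -EFinM lee_fin big_enum/=; apply: stopped_overlap => //.
move=> i j; rewrite !inE => /eqP li /eqP lj kij bij; rewrite -li -lj.
by apply: lsep; rewrite li lj; apply/andP; split; [apply/eqP|apply/asboolP].
Qed.

End discrete_square_function.

(** * The area functional *)

Section area_functional.
Context {R : realType} {n : nat}.
Variables (alpha : R) (Omega : set 'rV[R]_n.+1).
Hypothesis alpha_gt0 : 0 < alpha.
Hypothesis oO : open Omega.
Hypothesis b0 : bdry Omega !=set0.
Implicit Types (f g : 'rV[R]_n.+1 -> R) (xi x y : 'rV[R]_n.+1).

Lemma open_by_eballs (U : set 'rV[R]_n.+1) :
  (forall x, U x -> exists2 s, 0 < s & eball x s `<=` U) -> open U.
Proof.
move=> h; rewrite openE => x /h[s s0 sU].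
by rewrite /interior; apply: filterS sU _; apply: open_nbhs_nbhs; split;
  [exact: open_eball|exact: eball_center].
Qed.

Lemma delta_ge0 x : 0 <= delta Omega x.
Proof.
apply: lb_le_inf; first by case: b0 => y byy; exists (enorm (x - y)), y.
by move=> _ [y _ <-]; exact: enorm_ge0.
Qed.

Lemma measurable_delta (D : set 'rV[R]_n.+1) :
  measurable_fun (D : set (caratheodory_type leb_outer)) (delta Omega).
Proof.
apply: measurable_funTS.
apply: (measurability _ (RGenOInfty.measurableE R)) => //= _ [_ [r ->] <-].
rewrite setTI preimage_itvoy; apply: open_leb_measurable.
apply: open_by_eballs => x /= rx; exists (delta Omega x - r).
  by rewrite subr_gt0.
by move=> y; rewrite /eball/= => xy; have := delta_lip b0 x y; lra.
Qed.

Lemma measurable_div_delta (D : set 'rV[R]_n.+1) g m :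
  leb_outer.-cara.-measurable D -> D `<=` Omega -> Omega_measurable Omega g ->
  measurable_fun (D : set (caratheodory_type leb_outer))
    (fun x => (g x ^+ 2 / delta Omega x ^+ m)%:E).
Proof.
move=> mD DO mg; apply/measurable_EFinP.
have mgD : measurable_fun (D : set (caratheodory_type leb_outer)) g.
  apply: measurable_funS mg => //; exact: open_leb_measurable.
apply: measurable_funM; first exact: measurable_funX.
rewrite (_ : (fun x => _) = (fun x => (delta Omega x ^+ m) `^ (-1))).
  apply: (measurableT_comp (measurable_powR _)).
  by apply: measurable_funX; exact: measurable_delta.
by apply/funext => x; rewrite powR_inv1// exprn_ge0// delta_ge0.
Qed.

(** The inequality is between Lipschitz functions of [y]; the gap [c] is there for
    the semicontinuity argument of [open_area_sq_gt]. *)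
Lemma open_shrunk_cone xi (c : R) :
  open [set y | Omega y /\ enorm (xi - y) + c < (1 + alpha) * delta Omega y].
Proof.
apply: open_by_eballs => y [Oy yc].
have [s s0 sO] := eball_in_open oO Oy.
pose eta := ((1 + alpha) * delta Omega y - (enorm (xi - y) + c)) / (2 + alpha).
have eta0 : 0 < eta by rewrite divr_gt0 ?subr_gt0//; have := alpha_gt0; lra.
exists (Num.min s eta); first by rewrite lt_min s0.
move=> z; rewrite /eball/= lt_min => /andP[yz1 yz2]; split; first exact: sO.
have h1 := delta_lip b0 y z.
have h2 := enorm_triangle y xi z.
have : enorm (y - z) * (2 + alpha) < (1 + alpha) * delta Omega y - (enorm (xi - y) + c).
  by rewrite -ltr_pdivlMr//; have := alpha_gt0; lra.
have : (1 + alpha) * delta Omega y <= (1 + alpha) * (delta Omega z + enorm (y - z)).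
  by rewrite ler_wpM2l//; have := alpha_gt0; lra.
lra.
Qed.

Lemma open_cone xi : open (cone alpha Omega xi).
Proof.
rewrite (_ : cone _ _ _ =
    [set y | Omega y /\ enorm (xi - y) + 0 < (1 + alpha) * delta Omega y]).
  exact: open_shrunk_cone.
by apply/seteqP; split => y /=; rewrite addr0.
Qed.

Definition area_sq g xi : \bar R :=
  (\int[leb]_(x in cone alpha Omega xi) (g x ^+ 2 / delta Omega x ^+ n.+1)%:E)%E.

Lemma areaE g xi : area alpha Omega g xi = (area_sq g xi `^ 2^-1)%E.
Proof. by []. Qed.

Lemma density_ge0 g m x : (0 <= (g x ^+ 2 / delta Omega x ^+ m)%:E)%E.
Proof. by rewrite lee_fin divr_ge0 ?sqr_ge0// exprn_ge0// delta_ge0. Qed.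

Lemma area_sq_ge0 g xi : (0 <= area_sq g xi)%E.
Proof. by apply: integral_ge0 => x _; exact: density_ge0. Qed.

(** Cones at [xi] shrunk by a gap [k.+1%:R^-1] increase to the cone at [xi], so by
    monotone convergence one of them already carries an integral above [t]; and
    it is contained in the cones at all vertices closer to [xi] than the gap. *)
Lemma open_area_sq_gt g (t : \bar R) : Omega_measurable Omega g ->
  open [set xi | (t < area_sq g xi)%E].
Proof.
move=> mg; apply: open_by_eballs => xi /= txi.
pose F k := [set y | Omega y /\ enorm (xi - y) + k.+1%:R^-1 < (1 + alpha) * delta Omega y].
have coneE : cone alpha Omega xi = \bigcup_k F k.
  apply/seteqP; split => y.
    by move=> [Oy /ltr_add_invr[k yk]]; exists k.
  move=> [k _ [Oy yk]]; split => //; apply: lt_trans yk.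
  by rewrite ltrDl invr_gt0.
have mF k : leb_outer.-cara.-measurable (F k).
  by apply: open_leb_measurable; exact: open_shrunk_cone.
have nF : nondecreasing_seq F.
  move=> j k jk; apply/subsetPset => y [Oy yj]; split => //; apply: le_lt_trans yj.
  by rewrite lerD2l lef_pV2 ?posrE// ler_nat.
have := @ge0_nondecreasing_set_cvg_integral _
  (caratheodory_type (@leb_outer R n)) R F
  (fun x => (g x ^+ 2 / delta Omega x ^+ n.+1)%:E) leb nF mF.
have mh k : measurable_fun (F k : set (caratheodory_type leb_outer))
    (fun x => (g x ^+ 2 / delta Omega x ^+ n.+1)%:E).
  by apply: measurable_div_delta => // y [].
move=> /(_ mh (fun k x _ => density_ge0 g n.+1 x)).
rewrite -coneE => cvgF.
have [k tk] : exists k,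
    (t < \int[leb]_(x in F k) (g x ^+ 2 / delta Omega x ^+ n.+1)%:E)%E.
  apply: contrapT => /forallNP h; move: txi; apply/negP; rewrite -leNgt.
  rewrite /area_sq -(cvg_lim _ cvgF)//; apply: lime_le.
    by apply/cvg_ex; eexists; exact: cvgF.
  by apply: nearW => k; rewrite leNgt; apply/negP/h.
exists k.+1%:R^-1; first by rewrite invr_gt0.
move=> eta; rewrite /eball/= => xe; apply: (lt_le_trans tk).
have mC : leb_outer.-cara.-measurable (cone alpha Omega eta).
  exact/open_leb_measurable/open_cone.
apply: (ge0_subset_integral _ (mF k) mC).
- exact: measurable_div_delta mC (fun y => @proj1 _ _) mg.
- by move=> x _; exact: density_ge0.
move=> y [Oy yk]; split => //; apply: le_lt_trans yk.
apply: (le_trans (enorm_triangle xi eta y)).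
by rewrite addrC lerD2l enormB ltW.
Qed.

Lemma measurable_area_sq g : Omega_measurable Omega g ->
  measurable_fun setT
    (area_sq g : caratheodory_type (sigma_outer Omega) -> \bar R).
Proof.
move=> mg; apply: (measurability _ (ErealGenOInfty.measurableE R)) => //=.
move=> _ [_ [t ->] <-]; rewrite setTI preimage_itvoy.
apply: open_sigma_measurable; exact: open_area_sq_gt.
Qed.

Lemma measurable_area g : Omega_measurable Omega g ->
  measurable_fun setT
    (area alpha Omega g : caratheodory_type (sigma_outer Omega) -> \bar R).
Proof.
by move=> mg; apply: (measurableT_comp (measurable_poweR _)); exact: measurable_area_sq.
Qed.

Lemma le_area_sq g f xi : Omega_measurable Omega g -> Omega_measurable Omega f ->
  (forall x, Omega x -> `|g x| <= `|f x|) -> (area_sq g xi <= area_sq f xi)%E.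
Proof.
move=> mg mf gf.
have mC : leb_outer.-cara.-measurable (cone alpha Omega xi).
  exact/open_leb_measurable/open_cone.
apply: (ge0_le_integral _ mC).
- by move=> x _; exact: density_ge0.
- exact: measurable_div_delta mC (fun y => @proj1 _ _) mg.
- exact: measurable_div_delta mC (fun y => @proj1 _ _) mf.
move=> x [Ox _]; rewrite lee_fin ler_wpM2r ?invr_ge0 ?exprn_ge0 ?delta_ge0//.
by rewrite -(real_normK (num_real (g x))) -(real_normK (num_real (f x))) ler_sqr ?nnegrE ?gf.
Qed.

Lemma tent_norm_powR p g : 0 < p ->
  (tent_norm alpha p Omega g `^ p = \int[sigma Omega]_xi (area_sq g xi `^ (p / 2)))%E.
Proof.
move=> p0; rewrite /tent_norm poweR_Lnorm ?gt_eqF//.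
apply: eq_integral => xi _; rewrite gee0_abs ?poweR_ge0// areaE -poweRrM.
by rewrite mulrC.
Qed.

Lemma measurable_area_sq_poweR g r : Omega_measurable Omega g ->
  measurable_fun setT
    ((fun xi => area_sq g xi `^ r)%E : caratheodory_type (sigma_outer Omega) -> \bar R).
Proof.
by move=> mg; apply: (measurableT_comp (measurable_poweR _)); exact: measurable_area_sq.
Qed.

Lemma le_tent_norm_powR p f g : 0 < p -> Omega_measurable Omega g ->
  Omega_measurable Omega f -> (forall x, Omega x -> `|g x| <= `|f x|) ->
  (tent_norm alpha p Omega g `^ p <= tent_norm alpha p Omega f `^ p)%E.
Proof.
move=> p0 mg mf gf; rewrite (tent_norm_powR g p0) (tent_norm_powR f p0).
apply: ge0_le_integral.
- exact: measurableT.
- by move=> xi _; exact: poweR_ge0.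
- exact: measurable_area_sq_poweR.
- exact: measurable_area_sq_poweR.
move=> xi _; apply: gt0_ler_poweR; rewrite ?divr_ge0 ?(ltW p0)//.
- by rewrite in_itv/= area_sq_ge0 leey.
- by rewrite in_itv/= area_sq_ge0 leey.
exact: le_area_sq.
Qed.

(** This is how partial sums of the decomposition are seen to belong to the tent
    space. *)
Lemma tent_space_dominated p f g : 0 < p -> tent_space alpha p Omega f ->
  Omega_measurable Omega g -> (forall x, Omega x -> `|g x| <= `|f x|) ->
  tent_space alpha p Omega g.
Proof.
move=> p0 [[mf lf] _ nf] mg gf; split; [split => //|exact: measurable_area|].
  move=> K cK KO; apply: le_lt_trans (lf K cK KO).
  have mK := compact_leb_measurable cK.
  have mKg h : Omega_measurable Omega h ->
      measurable_fun (K : set (caratheodory_type leb_outer)) (fun x => (h x ^+ 2)%:E).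
    move=> mh; apply/measurable_EFinP; apply: measurable_funX.
    by apply: measurable_funS mh => //; exact: open_leb_measurable.
  apply: (ge0_le_integral _ mK _ (mKg _ mg) (mKg _ mf)).
    by move=> x _; rewrite lee_fin sqr_ge0.
  move=> x /KO Ox; rewrite lee_fin.
  by rewrite -(real_normK (num_real (g x))) -(real_normK (num_real (f x))) ler_sqr ?nnegrE ?gf.
have pn0 : p != 0 by rewrite gt_eqF.
apply: (@lty_poweRy _ _ p) => //; apply: le_lt_trans (poweR_lty p nf).
exact: le_tent_norm_powR.
Qed.

End area_functional.

(** * From a finite family of atoms to a convergent series *)

Lemma ae_leb_sub (R : realType) (n : nat) (P Q : 'rV[R]_n.+1 -> Prop) :
  (forall x, P x -> Q x) -> {ae leb, forall x, P x} -> {ae leb, forall x, Q x}.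
Proof. exact: (@filterS _ _ (ae_filter_ringOfSetsType leb)). Qed.

Section finite_atomic_sum.
Context {R : realType} {n : nat}.
Variables (alpha p : R) (Omega : set 'rV[R]_n.+1) (f : 'rV[R]_n.+1 -> R).
Hypothesis alpha_gt0 : 0 < alpha.
Hypothesis p_gt0 : 0 < p.
Hypothesis oO : open Omega.
Hypothesis b0 : bdry Omega !=set0.

Lemma tent_norm_ae0 (g : 'rV[R]_n.+1 -> R) : Omega_measurable Omega g ->
  {ae leb, forall x, Omega x -> g x = 0} -> tent_norm alpha p Omega g = 0%E.
Proof.
move=> mg g0; rewrite /tent_norm (eq_Lnorm _ _ (g := cst 0%E)).
  by rewrite Lnorm0// eqe gt_eqF.
move=> xi; rewrite areaE.
have mC : leb_outer.-cara.-measurable (cone alpha Omega xi).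
  exact/open_leb_measurable/open_cone.
rewrite (_ : area_sq _ _ _ _ = 0%E) ?poweR0r//.
rewrite /area_sq -[RHS](@integral0 _ (caratheodory_type (@leb_outer R n)) _ leb
  (cone alpha Omega xi)).
apply: (ae_eq_integral _ _ mC).
- exact: (measurable_div_delta oO b0 _ mC (fun y => @proj1 _ _) mg).
- exact: measurable_cst.
- apply: ae_leb_sub g0 => x g0 [/g0 -> _].
  by rewrite expr0n/= mul0r.
Qed.

(** Pads a finite family of atoms into a sequence. *)
Lemma zero_atom : Omega !=set0 -> bounded_set Omega \/ ~ bounded_set (bdry Omega) ->
  tent_atom p Omega (fun=> 0).
Proof.
move=> [x Ox] bO; split; first exact: measurable_cst.
have [xi bxi] := b0; exists xi, (delta Omega x); split => //.
- exact: delta_gt0.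
- by apply: le_lt_trans (enorm_lt_ediam oO bO Ox bxi); rewrite lee_fin delta_le.
- rewrite (eq_integral (cst 0%E)) ?integral0 ?poweR_ge0// => y _.
  by rewrite expr0n/= mul0r.
Qed.

Variables (I : finType) (lam : I -> R) (a : I -> 'rV[R]_n.+1 -> R)
  (G : I -> set 'rV[R]_n.+1).
Hypothesis zatom : tent_atom p Omega (fun=> 0).
Hypothesis atoms : forall i, tent_atom p Omega (a i).
Hypothesis lam_a : forall i x, lam i * a i x = f x * \1_(G i) x.
Hypothesis Gdisj : forall i j x, G i x -> G j x -> i = j.
Hypothesis tf : tent_space alpha p Omega f.
Hypothesis f_outside :
  {ae leb, forall x, Omega x -> ~ (exists i, G i x) -> f x = 0}.

(** Enumerating [I] and padding with zeros, the partial sums are restrictions of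
    [f] to increasing unions of the disjoint sets [G i]; from the rank [#|I|] on
    they agree with [f] almost everywhere. *)
Lemma finite_atomic_sum :
  exists (lambda : nat -> R) (A : nat -> 'rV[R]_n.+1 -> R),
    [/\ forall j, tent_atom p Omega (A j),
        tent_cvg alpha p Omega (fun N x => \sum_(j < N) lambda j * A j x) f &
        (\sum_(j <oo) (`|lambda j| `^ p)%:E = (\sum_i `|lam i| `^ p)%:E)%E].
Proof.
pose lambda j := if insub j : option 'I_#|I| is Some o then lam (enum_val o) else 0.
pose A j := if insub j : option 'I_#|I| is Some o then a (enum_val o) else fun=> 0.
pose H j : set 'rV[R]_n.+1 :=
  if insub j : option 'I_#|I| is Some o then G (enum_val o) else set0.
have atomA j : tent_atom p Omega (A j) by rewrite /A; case: insubP.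
have lamA j x : lambda j * A j x = f x * \1_(H j) x.
  rewrite /lambda /A /H; case: insubP => [k _ _|_]; first exact: lam_a.
  by rewrite mul0r indicE in_set0 mulr0.
have Hdisj j k x : H j x -> H k x -> j = k.
  rewrite /H; case: insubP => // o _ <-; case: insubP => // o' _ <- Ho Ho'.
  by rewrite (enum_val_inj (Gdisj Ho Ho')).
have sumE N x : \sum_(j < N) lambda j * A j x =
    if `[< exists2 j, (j < N)%N & H j x >] then f x else 0.
  rewrite (eq_bigr (fun j : 'I_N => f x * \1_(H j) x)); last by move=> j _; exact: lamA.
  case: asboolP => [[j jN Hj]|noH]; last first.
    rewrite big1// => j _; rewrite indicE memNset ?mulr0// => Hj.
    by apply: noH; exists j.
  rewrite (bigD1 (Ordinal jN))//= indicE mem_set// mulr1 big1 ?addr0// => k kj.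
  rewrite indicE memNset ?mulr0// => Hk; case/eqP: kj; apply: val_inj => /=.
  exact: Hdisj Hk Hj.
have mA j : Omega_measurable Omega (A j) by have [] := atomA j.
have msum N : Omega_measurable Omega (fun x => \sum_(j < N) lambda j * A j x).
  apply: measurable_sum => j; apply: measurable_funM; first exact: measurable_cst.
  exact: mA.
have mf : Omega_measurable Omega f by case: tf => -[].
exists lambda, A; split; first exact: atomA.
  split; [move=> N|exact: tf|].
    apply: (tent_space_dominated alpha_gt0 oO b0 p_gt0 tf (msum N)) => x Ox.
    by rewrite sumE; case: asboolP => _; rewrite ?normr0.
  apply: cvg_near_cst; exists #|I| => // N /= leIN.
  apply: tent_norm_ae0; first exact: measurable_funB mf (msum N).
  apply: ae_leb_sub f_outside => x f0 Ox; rewrite sumE.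
  case: asboolP => [_|noH]; first by rewrite subrr.
  rewrite subr0; apply: f0 => // -[i Gi]; apply: noH.
  exists (enum_rank i); first exact: leq_trans (ltn_ord _) leIN.
  by rewrite /H valK enum_rankK.
rewrite (nneseries_split 0 #|I|)/=; last by move=> k _; rewrite lee_fin powR_ge0.
rewrite add0n eseries0 ?adde0; last first.
  move=> k kI _; rewrite /lambda insubF ?normr0 ?powR0 ?gt_eqF//.
  by apply/negbTE; rewrite -leqNgt.
rewrite big_mkord sumEFin; congr EFin.
rewrite [RHS](reindex _ (onW_bij _ (@enum_val_bij I)))/=; apply: eq_bigr => o _.
by rewrite /lambda valK.
Qed.

End finite_atomic_sum.

(** * Pieces of the domain and the atoms built from them *)

Section pieces.
Context {R : realType} {n : nat}.
Variable Omega : set 'rV[R]_n.+1.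
Hypothesis oO : open Omega.
Hypothesis b0 : bdry Omega !=set0.

Lemma disjoint_small_pieces (K : set 'rV[R]_n.+1) (e : R) :
  0 < e -> compact K -> K `<=` Omega ->
  exists N (y : 'I_N -> 'rV[R]_n.+1) (P : 'I_N -> set 'rV[R]_n.+1),
    [/\ forall i, Omega (y i), forall i, leb_outer.-cara.-measurable (P i),
      forall i, P i `<=` K `&` eball (y i) (e * delta Omega (y i)),
      forall i j x, P i x -> P j x -> i = j &
      K `<=` \bigcup_i P i].
Proof.
move=> e0 cK KO; have [N [y [yK Ky]]] := finite_delta_cover oO b0 e0 cK KO.
pose B i := eball (y i) (e * delta Omega (y i)).
pose P (i : 'I_N) := (K `&` B i) `\` \bigcup_(j < i) B j.
exists N, (fun i => y i), P; split.
- by move=> i; apply/KO/yK.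
- move=> i; apply: measurableD.
    apply: measurableI; first exact: compact_leb_measurable.
    by apply: open_leb_measurable; exact: open_eball.
  by apply: open_leb_measurable; apply: bigcup_open => j _; exact: open_eball.
- by move=> i x [].
- suff lt_disj (i j : 'I_N) x : P i x -> P j x -> (i < j)%N -> False.
    move=> i j x Pi Pj; apply: val_inj => /=; case: (ltngtP i j) => // ij.
      by case: (lt_disj i j x).
    by case: (lt_disj j i x).
  by move=> [[_ Bi] _] [_ +] ij; apply; exists i.
move=> x Kx; have exi : exists i, (i < N)%N && `[< B i x >].
  by have [i iN Bi] := Ky x Kx; exists i; rewrite iN; apply/asboolP.
case: (ex_minnP exi) => i /andP[iN /asboolP Bi] imin.
exists (Ordinal iN) => //; split => // -[j /= ji Bj].
have := imin j; rewrite (ltn_trans ji iN) leqNgt ji => /(_ _)/negP; apply => //.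
by apply/asboolP.
Qed.

End pieces.

Section decomposition.
Context {R : realType} {n : nat}.
Variables (alpha p C0 : R).
Hypothesis alpha_gt0 : 0 < alpha.
Hypothesis p_gt0 : 0 < p.
Hypothesis p_le1 : p <= 1.
Hypothesis C0_gt0 : 0 < C0.
Variable Omega : set 'rV[R]_n.+1.
Hypothesis oO : open Omega.
Hypothesis b0 : bdry Omega !=set0.
Hypothesis ahlfors : ahlfors_regular C0 (bdry Omega).
Implicit Types (x y xi : 'rV[R]_n.+1).

(** The size of pieces and of their boundary balls relative to the distance to the
    boundary: small enough for [piece_sub_cone], and below 1/6 so that tripled
    boundary balls stay smaller than the diameter of the boundary. *)
Definition scale : R := alpha / (6 + 6 * alpha).

Lemma scale_gt0 : 0 < scale.
Proof. by rewrite divr_gt0//; have := alpha_gt0; lra. Qed.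

Lemma scale_alpha : scale * (6 + 6 * alpha) = alpha.
Proof. by rewrite /scale; field; have := alpha_gt0; lra. Qed.

Lemma scale_lt : scale < 6^-1.
Proof.
by rewrite /scale ltr_pdivrMr; have := alpha_gt0; lra.
Qed.

(** With h = scale * delta Omega y, the distance from [x] to [eta] is less than
    [delta Omega y + 3 * h], and [delta Omega x] is more than [delta Omega y - h];
    the aperture absorbs both errors. *)
Lemma piece_sub_cone x y xi eta : Omega x -> Omega y ->
  enorm (y - xi) < delta Omega y + scale * delta Omega y ->
  eball y (scale * delta Omega y) x ->
  eball xi (scale * delta Omega y) eta ->
  cone alpha Omega eta x.
Proof.
rewrite /eball/= => Ox Oy yxi yx xieta; split => //.
have d0 := delta_gt0 oO b0 Oy.
have h1 := delta_lip b0 y x.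
have h2 := enorm_triangle xi eta x.
have h3 := enorm_triangle y xi x.
rewrite (enormB eta xi) (enormB xi y) in h2 h3.
have sd : 0 < scale * delta Omega y by rewrite mulr_gt0// scale_gt0.
have al : alpha * delta Omega y = 6 * (scale * delta Omega y) +
    6 * (alpha * (scale * delta Omega y)).
  by rewrite -{1}scale_alpha; ring.
have al2 : alpha * (delta Omega y - scale * delta Omega y) <= alpha * delta Omega x.
  by rewrite ler_wpM2l//; have := alpha_gt0; lra.
have asd : 0 < alpha * (scale * delta Omega y) by rewrite mulr_gt0.
have := scale_lt; lra.
Qed.

Lemma piece_delta_le x y : eball y (scale * delta Omega y) x ->
  delta Omega x <= (1 + scale) * delta Omega y.
Proof.
rewrite /eball/= => yx; have := delta_lip b0 x y; rewrite enormB; lra.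
Qed.

Lemma piece_delta_ge x y : eball y (scale * delta Omega y) x ->
  (1 - scale) * delta Omega y <= delta Omega x.
Proof. by rewrite /eball/= => yx; have := delta_lip b0 y x; lra. Qed.

Lemma sigma_eball xi r : bdry Omega xi -> 0 < r ->
  (r%:E <= ediam (bdry Omega))%E ->
  ((C0^-1 * r ^+ n)%:E <= sigma Omega (eball xi r) <= (C0 * r ^+ n)%:E)%E.
Proof.
move=> bxi r0 rD; have [_ /(_ xi r bxi r0 rD)] := ahlfors.
by rewrite setIC.
Qed.

Lemma sigma_eballE xi r : bdry Omega xi -> 0 < r ->
  (r%:E <= ediam (bdry Omega))%E ->
  exists v, [/\ 0 < v, sigma Omega (eball xi r) = v%:E,
    C0^-1 * r ^+ n <= v & v <= C0 * r ^+ n].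
Proof.
move=> bxi r0 rD; have /andP[] := sigma_eball bxi r0 rD.
case: (sigma Omega (eball xi r)) => [v|//|//]; rewrite !lee_fin => vl vu.
exists v; split => //; apply: lt_le_trans vl.
by rewrite mulr_gt0 ?invr_gt0// exprn_gt0.
Qed.

Section grouped_pieces.
Context {I : finType}.
Variables (f : 'rV[R]_n.+1 -> R) (P : I -> set 'rV[R]_n.+1) (w : I -> R).
Hypothesis mf : Omega_measurable Omega f.
Hypothesis mP : forall i, leb_outer.-cara.-measurable (P i).
Hypothesis PO : forall i, P i `<=` Omega.
Hypothesis Pdisj : forall i j x, P i x -> P j x -> i = j.
Hypothesis w_gt0 : forall i, 0 < w i.
Hypothesis wE : forall i,
  (\int[leb]_(x in P i) (f x ^+ 2 / delta Omega x)%:E = (w i)%:E)%E.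

(** The exponent [m] is 1 for the atom condition and [n.+1] for the area function. *)
Lemma integral_pieces (J : {pred I}) m :
  (\int[leb]_(x in \bigcup_(i in [set` enum J]) P i)
      (f x ^+ 2 / delta Omega x ^+ m)%:E =
   \sum_(i in J) \int[leb]_(x in P i) (f x ^+ 2 / delta Omega x ^+ m)%:E)%E.
Proof.
rewrite bigcup_seq ge0_integral_bigsetU.
- by rewrite big_enum.
- exact: mP.
- exact: enum_uniq.
- by move=> i j _ _ [x [Pi Pj]]; exact: Pdisj Pi Pj.
- rewrite -bigcup_seq; apply: (measurable_div_delta oO b0) => //.
    apply: (@fin_bigcup_measurable _ (caratheodory_type (@leb_outer R n))).
      exact: finite_seq.
    by move=> i _; exact: mP.
  by move=> x [i _ /PO].
- by move=> x _; exact: density_ge0.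
Qed.

(** The coefficient makes the atom condition an equality. An empty group gives
    [lam = 0], hence the zero atom. *)
Lemma grouped_atom (J : {pred I}) xi r V :
  bdry Omega xi -> 0 < r -> (r%:E < ediam (bdry Omega))%E ->
  (forall i, i \in J -> P i `<=` eball xi r) ->
  0 < V -> sigma Omega (eball xi r) = V%:E ->
  let lam := ((\sum_(i in J) w i) * V `^ (2 / p - 1)) `^ 2^-1 in
  let G := \bigcup_(i in [set` enum J]) P i in
  let a x := lam^-1 * (f x * \1_G x) in
  tent_atom p Omega a /\ forall x, lam * a x = f x * \1_G x.
Proof.
move=> bxi r0 rD PB V0 VE; set W := \sum_(i in J) w i => lam G a.
have mG : leb_outer.-cara.-measurable G.
  apply: (@fin_bigcup_measurable _ (caratheodory_type (@leb_outer R n))).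
    exact: finite_seq.
  by move=> i _; exact: mP.
have GB : G `<=` eball xi r `&` Omega.
  move=> x [i /=]; rewrite mem_enum => iJ Pi.
  by split; [exact: PB Pi|exact: PO Pi].
have W0 : 0 <= W by apply: sumr_ge0 => i _; exact: ltW.
have lam2 : lam ^+ 2 = W * V `^ (2 / p - 1).
  rewrite -powR_mulrn ?powR_ge0// /lam -powRrM mulVf ?powRr1//.
  by rewrite mulr_ge0// powR_ge0.
have intG : (\int[leb]_(x in G) (f x ^+ 2 / delta Omega x)%:E = W%:E)%E.
  rewrite (integral_pieces J 1) -sumEFin; apply: eq_bigr => i _; exact: wE.
have mD : leb_outer.-cara.-measurable (eball xi r `&` Omega).
  by apply: measurableI; apply: open_leb_measurable => //; exact: open_eball.
split; last first.
  move=> x; rewrite /a; have [lam0|lam0] := eqVneq lam 0; last by rewrite mulVKf.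
  have W00 : W = 0.
    move/eqP: lam2; rewrite lam0 expr0n/= eq_sym mulf_eq0 => /orP[/eqP//|].
    by rewrite (gt_eqF (powR_gt0 _ V0)).
  rewrite lam0 mul0r indicE memNset ?mulr0// => -[i /=]; rewrite mem_enum => iJ _.
  have := w_gt0 i; suff -> : w i = 0 by rewrite ltxx.
  move: W00 => /eqP; rewrite psumr_eq0; last by move=> j _; exact: ltW.
  by move=> /allP/(_ i (mem_index_enum _)); rewrite iJ => /eqP.
split.
  apply: measurable_funM; first exact: measurable_cst.
  apply: measurable_funM; first exact: mf.
  by apply: measurable_funTS; exact: measurable_indic.
exists xi, r; split => //.
  by move=> x Bx; rewrite /a indicE memNset ?mulr0// => /GB.
have -> : (\int[leb]_(x in eball xi r `&` Omega) (a x ^+ 2 / delta Omega x)%:E =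
    \int[leb]_(x in eball xi r `&` Omega)
      (((fun x => (lam ^- 2)%:E * (f x ^+ 2 / delta Omega x)%:E)%E \_ G) x))%E.
  apply: eq_integral => x _; rewrite patchE /a indicE; case: ifPn => [xG|/negbTE xG].
    by rewrite /= mulr1 -EFinM exprMn exprVn -mulrA.
  by rewrite /= !mulr0 expr0n/= mul0r.
rewrite -integral_mkcondr (_ : _ `&` G = G); last exact/setIidr.
have GO : G `<=` Omega by move=> x /GB[].
have lam2i : 0 <= lam ^- 2 by rewrite invr_ge0 exprn_ge0// powR_ge0.
rewrite (ge0_integralZl_EFin _ mG (fun x _ => density_ge0 b0 f 1 x)
  (measurable_div_delta oO b0 1 mG GO mf) lam2i).
have -> : sigma Omega (eball xi r `&` bdry Omega) = V%:E.
  by rewrite -VE /sigma/= /sigma_outer -setIA setIid.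
rewrite intG poweR_EFin -EFinM lee_fin lam2.
have [->|Wn0] := eqVneq W 0; first by rewrite mulr0 powR_ge0.
by rewrite invfM mulrAC mulVf// mul1r -powRN opprB.
Qed.

(** When [eta] lies in the i-th boundary ball, the cone at [eta] contains the whole
    piece [P i], on which [delta Omega] is comparable to the radius of that ball;
    the disjoint pieces so obtained add up inside the cone. *)
Lemma dsq_le_area (y xi : I -> 'rV[R]_n.+1) (v : I -> R) eta :
  (forall i, Omega (y i)) ->
  (forall i, P i `<=` eball (y i) (scale * delta Omega (y i))) ->
  (forall i, enorm (y i - xi i) <
    delta Omega (y i) + scale * delta Omega (y i)) ->
  (forall i, C0^-1 * (scale * delta Omega (y i)) ^+ n <= v i) ->
  ((@dsq _ (caratheodory_type (sigma_outer Omega)) R I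
      (fun i => eball (xi i) (scale * delta Omega (y i))) v w eta)%:E <=
   (C0 * ((1 + scale) / scale) ^+ n)%:E * area_sq alpha Omega f eta)%E.
Proof.
move=> Oy Py yxi vlow; have s0 := scale_gt0.
pose b i := eball (xi i) (scale * delta Omega (y i)).
pose J := [pred i | eta \in b i].
pose Cs := C0 * ((1 + scale) / scale) ^+ n.
have Cs0 : 0 < Cs by rewrite mulr_gt0// exprn_gt0// divr_gt0// addr_gt0.
have d0 i : 0 < delta Omega (y i) by exact: delta_gt0 (Oy i).
have -> : @dsq _ (caratheodory_type (sigma_outer Omega)) R I b v w eta = \sum_(i in J) w i / v i.
  rewrite /dsq [RHS]big_mkcond/=; apply: eq_bigr => i _.
  by rewrite inE indicE; case: (eta \in b i); rewrite ?mulr1 ?mulr0.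
pose D i := ((1 + scale) * delta Omega (y i)) ^+ n.
have D0 i : 0 < D i by rewrite exprn_gt0// mulr_gt0// addr_gt0.
have termle i : w i / v i <= Cs * (w i / D i).
  rewrite mulrCA ler_wpM2l ?(ltW (w_gt0 i))//.
  have l0 : 0 < C0^-1 * (scale * delta Omega (y i)) ^+ n.
    by rewrite mulr_gt0 ?invr_gt0// exprn_gt0// mulr_gt0.
  rewrite -[leLHS]mul1r ler_pdivrMr; last exact: lt_le_trans l0 (vlow i).
  apply: le_trans (ler_wpM2l _ (vlow i)); last by rewrite divr_ge0// ltW.
  rewrite /Cs /D expr_div_n (exprMn n (1 + scale)) (exprMn n scale) le_eqVlt.
  apply/orP; left; apply/eqP.
  have A0 : (1 + scale) ^+ n != 0 by rewrite expf_neq0// gt_eqF// addr_gt0.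
  have B0 : scale ^+ n != 0 by rewrite expf_neq0// gt_eqF.
  have E0 : delta Omega (y i) ^+ n != 0 by rewrite expf_neq0// gt_eqF.
  move: A0 B0 E0; move: (_ ^+ n) (scale ^+ n) (delta Omega (y i) ^+ n) => A B E A0 B0 E0.
  by field; rewrite A0 B0 E0 gt_eqF.
have mC : leb_outer.-cara.-measurable (cone alpha Omega eta).
  by apply: open_leb_measurable; exact: open_cone.
have GC : \bigcup_(i in [set` enum J]) P i `<=` cone alpha Omega eta.
  move=> x [i /=]; rewrite mem_enum => /set_mem bi Pi.
  exact: (piece_sub_cone (PO Pi) (Oy i) (yxi i) (Py i x Pi) bi).
apply: (@le_trans _ _ (Cs%:E * \int[leb]_(x in \bigcup_(i in [set` enum J]) P i)
    (f x ^+ 2 / delta Omega x ^+ n.+1)%:E)%E); last first.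
  apply: lee_wpmul2l; first by rewrite lee_fin ltW.
  apply: (ge0_subset_integral _ _ mC).
  - apply: (@fin_bigcup_measurable _ (caratheodory_type (@leb_outer R n))).
      exact: finite_seq.
    by move=> i _; exact: mP.
  - exact: (measurable_div_delta oO b0 _ mC (fun x => @proj1 _ _) mf).
  - by move=> x _; exact: density_ge0.
  - exact: GC.
rewrite integral_pieces -sumEFin ge0_sume_distrr; last first.
  by move=> i _; apply: integral_ge0 => x _; exact: density_ge0.
apply: lee_sum => i _; apply: (@le_trans _ _ (Cs * (w i / D i))%:E).
  by rewrite lee_fin termle.
rewrite EFinM lee_wpmul2l ?lee_fin ?(ltW Cs0)// mulrC EFinM -wE.
have Di0 : 0 <= (D i)^-1 by rewrite invr_ge0 ltW.
rewrite -(ge0_integralZl_EFin _ (mP i) (fun x _ => density_ge0 b0 f 1 x)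
  (measurable_div_delta oO b0 1 (mP i) (@PO i) mf) Di0).
apply: (ge0_le_integral _ (mP i)).
- by move=> x _; rewrite mule_ge0 ?lee_fin ?invr_ge0 ?(ltW (D0 i))//; exact: (density_ge0 b0 f 1).
- exact: measurable_funeM (measurable_div_delta oO b0 1 (mP i) (@PO i) mf).
- exact: (measurable_div_delta oO b0 _ (mP i) (@PO i) mf).
move=> x Pi; rewrite -EFinM lee_fin.
have dx := delta_gt0 oO b0 (PO Pi).
have -> : (D i)^-1 * (f x ^+ 2 / delta Omega x) =
    f x ^+ 2 * ((delta Omega x)^-1 * (D i)^-1) by ring.
have -> : f x ^+ 2 / delta Omega x ^+ n.+1 =
    f x ^+ 2 * ((delta Omega x)^-1 * (delta Omega x ^+ n)^-1).
  by rewrite [delta Omega x ^+ n.+1]exprS invfM.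
rewrite ler_wpM2l ?sqr_ge0// ler_wpM2l ?invr_ge0 ?(ltW dx)//.
rewrite lef_pV2 ?posrE ?D0 ?exprn_gt0//; apply: lerXn2r; rewrite ?nnegrE ?(ltW dx)//.
  by rewrite mulr_ge0 ?addr_ge0 ?(ltW s0) ?(ltW (d0 i)).
exact: piece_delta_le (Py i x Pi).
Qed.

End grouped_pieces.

End decomposition.

(** * The atomic decomposition *)

Section atomic_decomposition.
Context {R : realType} {n : nat}.
Variables (alpha p C0 : R).
Hypothesis alpha_gt0 : 0 < alpha.
Hypothesis p_gt0 : 0 < p.
Hypothesis p_le1 : p <= 1.
Hypothesis C0_gt0 : 0 < C0.

Let s : R := scale alpha.
(* A point of a piece is within (s^-1 + 4) * r of the centre of the leader of the
   piece, where r is the radius of the leader's ball. *)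
Let Lam : R := s^-1 + 4.

(** The three factors are the constant of [discrete_decomposition], the ratio of
    the surface measures of an enlarged leader and of the leader itself, and the
    p/2-th power of the constant of [dsq_le_area]. *)
Definition atomic_constant : R :=
  16 * (C0 ^+ 2 * ((scale alpha)^-1 + 4) ^+ n) *
  (C0 * ((1 + scale alpha) / scale alpha) ^+ n) `^ (p / 2).

Lemma atomic_constant_gt0 : 0 < atomic_constant.
Proof.
have s0 := scale_gt0 alpha_gt0.
have C1 : 0 < C0 * ((1 + scale alpha) / scale alpha) ^+ n.
  by rewrite mulr_gt0// exprn_gt0// divr_gt0// addr_gt0.
apply: mulr_gt0; last exact: powR_gt0.
apply: mulr_gt0 => //; apply: mulr_gt0; first exact: exprn_gt0.
by apply: exprn_gt0; apply: addr_gt0; rewrite ?invr_gt0.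
Qed.

Variable Omega : set 'rV[R]_n.+1.
Hypothesis oO : open Omega.
Hypothesis O0 : Omega !=set0.
Hypothesis bO : bounded_set Omega \/ ~ bounded_set (bdry Omega).
Hypothesis ahlfors : ahlfors_regular C0 (bdry Omega).
Variable f : 'rV[R]_n.+1 -> R.
Hypothesis tf : tent_space alpha p Omega f.
Variable K : set 'rV[R]_n.+1.
Hypothesis cK : compact K.
Hypothesis KO : K `<=` Omega.
Hypothesis fK : {ae leb, forall x, Omega x -> ~ K x -> f x = 0}.

Let b0 : bdry Omega !=set0. Proof. exact: bdry_neq0. Qed.
Let s0 : 0 < s. Proof. exact: scale_gt0. Qed.
Let s6 : s < 6^-1. Proof. exact: scale_lt. Qed.
Let mf : Omega_measurable Omega f. Proof. by case: tf => -[]. Qed.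

Lemma piece_energy_fin y (P : set 'rV[R]_n.+1) : Omega y ->
  leb_outer.-cara.-measurable P ->
  P `<=` K `&` eball y (s * delta Omega y) ->
  (\int[leb]_(x in P) (f x ^+ 2 / delta Omega x)%:E)%E \is a fin_num.
Proof.
move=> Oy mP PK; have d0 := delta_gt0 oO b0 Oy.
have PO : P `<=` Omega by move=> x /PK[/KO].
have c0 : 0 < (1 - s) * delta Omega y by rewrite mulr_gt0//; have := s6; lra.
have mK := compact_leb_measurable cK.
have m2 (D : set 'rV[R]_n.+1) : leb_outer.-cara.-measurable D -> D `<=` Omega ->
    measurable_fun (D : set (caratheodory_type leb_outer)) (fun x => (f x ^+ 2)%:E).
  move=> mD DO; apply/measurable_EFinP; apply: measurable_funX.
  by apply: measurable_funS mf => //; exact: open_leb_measurable.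
have f2_ge0 (x : 'rV[R]_n.+1) : (0 <= (f x ^+ 2)%:E)%E by rewrite lee_fin sqr_ge0.
rewrite ge0_fin_numE; last by apply: integral_ge0 => x _; exact: (density_ge0 b0 f 1).
apply: (@le_lt_trans _ _ ((((1 - s) * delta Omega y)^-1)%:E *
    \int[leb]_(x in K) (f x ^+ 2)%:E)%E); last first.
  rewrite lte_mul_pinfty ?lee_fin ?invr_ge0 ?(ltW c0)//.
  by case: tf => -[_ /(_ K cK KO)].
apply: (@le_trans _ _ ((((1 - s) * delta Omega y)^-1)%:E *
    \int[leb]_(x in P) (f x ^+ 2)%:E)%E); last first.
  rewrite lee_wpmul2l ?lee_fin ?invr_ge0 ?(ltW c0)//.
  by apply: (ge0_subset_integral _ mP mK (m2 _ mK KO)) => // x /PK[].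
have ci0 : 0 <= ((1 - s) * delta Omega y)^-1 by rewrite invr_ge0 ltW.
rewrite -(ge0_integralZl_EFin _ mP (fun x _ => f2_ge0 x) (m2 _ mP PO) ci0).
apply: (ge0_le_integral _ mP).
- by move=> x _; exact: (density_ge0 b0 f 1).
- exact: (measurable_div_delta oO b0 1 mP PO mf).
- exact: measurable_funeM (m2 _ mP PO).
move=> x Px; rewrite -EFinM lee_fin mulrC ler_wpM2r ?sqr_ge0//.
rewrite lef_pV2 ?posrE ?delta_gt0//; last exact: PO.
exact: piece_delta_ge (PK x Px).2.
Qed.

Lemma atomic_decomposition :
  exists (lambda : nat -> R) (a : nat -> 'rV[R]_n.+1 -> R),
    [/\ forall j, tent_atom p Omega (a j),
        tent_cvg alpha p Omega (fun N x => \sum_(j < N) lambda j * a j x) f &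
        (\sum_(j <oo) (`|lambda j| `^ p)%:E
          <= atomic_constant%:E * tent_norm alpha p Omega f `^ p)%E].
Proof.
have [N [y [P [yO mP PB Pdisj KP]]]] := disjoint_small_pieces oO b0 s0 cK KO.
have PO i : P i `<=` Omega by move=> x /PB[/KO].
have d0 i : 0 < delta Omega (y i) by exact: delta_gt0.
pose r i := s * delta Omega (y i).
have r0 i : 0 < r i by rewrite mulr_gt0.
have /choice[xi bxi_yxi] i : exists xi, bdry Omega xi /\
    enorm (y i - xi) < delta Omega (y i) + r i.
  by have [xi bxi yxi] := delta_approx b0 (y i) (r0 i); exists xi.
have bxi i := (bxi_yxi i).1; have yxi i := (bxi_yxi i).2.
have r3_diam i : ((3 * r i)%:E < ediam (bdry Omega))%E.
  apply: le_lt_trans (enorm_lt_ediam oO bO (yO i) (bxi i)); rewrite lee_fin.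
  apply: le_trans (delta_le b0 (y i) (bxi i)).
  rewrite /r mulrA ler_piMl ?(ltW (d0 i))//; have := s6; lra.
have r_diam i : ((r i)%:E <= ediam (bdry Omega))%E.
  by apply: le_trans (ltW (r3_diam i)); rewrite lee_fin; have := r0 i; lra.
have /choice[v vP] i := sigma_eballE C0_gt0 ahlfors (bxi i) (r0 i) (r_diam i).
pose W i := (\int[leb]_(x in P i) (f x ^+ 2 / delta Omega x)%:E)%E.
have W_ge0 i : (0 <= W i)%E by apply: integral_ge0 => x _; exact: (density_ge0 b0 f 1).
have W_fin i : W i \is a fin_num by exact: piece_energy_fin (yO i) (mP i) (PB i).
(* pieces without energy are dropped: f vanishes almost everywhere on them *)
pose I := {i : 'I_N | 0 < fine (W i)}.
pose w (i : I) := fine (W (val i)).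
have w_gt0 i : 0 < w i := valP i.
pose b (i : I) := eball (xi (val i)) (r (val i)).
have /choice[rho rhoP] (i : I) : exists rho, K `<=` eball (xi (val i)) rho /\
    (rho%:E < ediam (bdry Omega))%E.
  by have [rho ? ?] := compact_in_boundary_ball oO bO O0 cK KO (bxi (val i)); exists rho.
(* the enlarged ball is capped at a radius below the diameter of the boundary,
   which still contains K, but never shrinks below the tripled ball *)
pose Rad (i : I) := Num.min (Lam * r (val i)) (Num.max (rho i) (3 * r (val i))).
have Lam3 : 3 <= Lam.
  by rewrite /Lam -lerBlDr (@le_trans _ _ 0) ?invr_ge0 ?(ltW s0)//; lra.
have Rad3 i : 3 * r (val i) <= Rad i.
  by rewrite le_min ler_wpM2r ?(ltW (r0 _))//= le_max lexx orbT.
have Rad0 i : 0 < Rad i by apply: lt_le_trans (Rad3 i); rewrite mulr_gt0.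
have Rad_diam i : ((Rad i)%:E < ediam (bdry Omega))%E.
  apply: (@le_lt_trans _ _ (Num.max (rho i) (3 * r (val i)))%:E).
    by rewrite lee_fin ge_min lexx orbT.
  by rewrite maxEle; case: ifP => _; [exact: r3_diam|exact: (rhoP i).2].
have /choice[V VP] i := sigma_eballE C0_gt0 ahlfors (bxi (val i)) (Rad0 i) (ltW (Rad_diam i)).
pose M := C0 ^+ 2 * Lam ^+ n.
have M0 : 0 <= M by rewrite mulr_ge0 ?exprn_ge0 ?(ltW C0_gt0)//; have := Lam3; lra.
have VM i : V i <= M * v (val i).
  have [_ _ _ /le_trans] := VP i; apply.
  have [_ _ vlow _] := vP (val i).
  apply: (@le_trans _ _ (C0 * (Lam * r (val i)) ^+ n)).
    rewrite ler_wpM2l ?(ltW C0_gt0)//; apply: lerXn2r; rewrite ?nnegrE ?(ltW (Rad0 i))//.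
      by rewrite mulr_ge0 ?(ltW (r0 _))//; have := Lam3; lra.
    by rewrite ge_min lexx.
  rewrite /M exprMn (_ : C0 * _ = C0 ^+ 2 * Lam ^+ n * (C0^-1 * r (val i) ^+ n)).
    by rewrite ler_wpM2l.
  by field; rewrite gt_eqF.
have [||||||l [ll lb lr lsum]] := @discrete_decomposition _
    (caratheodory_type (sigma_outer Omega)) R (sigma Omega) I b
    (fun i => v (val i)) w p _ _ _ _ _ _ (fun i => r (val i)).
- by move=> i; apply: open_sigma_measurable; exact: open_eball.
- by move=> i; have [] := vP (val i).
- by move=> i; have [] := vP (val i).
- exact: w_gt0.
- exact: p_gt0.
- exact: p_le1.
have [u uP] : exists u : I -> 'rV[R]_n.+1, forall i, b (l i) (u i) /\ b i (u i).
  by have /choice[u uP] i := lb i; exists u.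
have near_leader i z : b i z -> enorm (xi (val (l i)) - z) < 3 * r (val (l i)).
  rewrite /b /eball/= => iz; have [] := uP i; rewrite /b /eball/= => lu iu.
  have := enorm_triangle (u i) (xi (val (l i))) z.
  have := enorm_triangle (xi (val i)) (u i) z.
  rewrite (enormB (u i) (xi (val i))); have := lr i; lra.
have bB i : b i `<=` eball (xi (val (l i))) (Rad (l i)).
  by move=> z /near_leader; rewrite /eball/= => /lt_le_trans; apply; exact: Rad3.
have PR (k : I) i : l i = k -> P (val i) `<=` eball (xi (val k)) (Rad k).
  move=> <- x Pix; have [Kx xy] := PB _ _ Pix.
  rewrite /eball/= lt_min lt_max ((rhoP (l i)).1 x Kx) andbT.
  have [] := uP i; rewrite /b /eball/= => lu iu.
  have h1 := enorm_triangle (u i) (xi (val (l i))) x.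
  have h2 := enorm_triangle (xi (val i)) (u i) x.
  have h3 := enorm_triangle (y (val i)) (xi (val i)) x.
  rewrite (enormB (u i) (xi _)) in h2; rewrite (enormB (xi (val i)) (y _)) in h3.
  have h4 := yxi (val i); have h5 := lr i.
  have h6 : delta Omega (y (val i)) <= s^-1 * r (val (l i)).
    by rewrite ler_pdivlMl.
  rewrite /eball/= -/(r (val i)) in xy.
  rewrite /Lam mulrDl; lra.
pose PI (i : I) := P (val i).
have PIdisj (i j : I) x : PI i x -> PI j x -> i = j.
  by move=> Pi Pj; apply: val_inj; exact: Pdisj Pi Pj.
have wE (i : I) : (\int[leb]_(x in PI i) (f x ^+ 2 / delta Omega x)%:E = (w i)%:E)%E.
  by rewrite fineK.
pose J k := [pred i | l i == k].
pose lam k := ((\sum_(i in J k) w i) * V k `^ (2 / p - 1)) `^ 2^-1.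
pose G k := \bigcup_(i in [set` enum (J k)]) PI i.
pose a k x := (lam k)^-1 * (f x * \1_(G k) x).
have atoms k : tent_atom p Omega (a k) /\ forall x, lam k * a k x = f x * \1_(G k) x.
  apply: (grouped_atom p oO b0 mf (fun i => mP (val i)) (fun i => PO (val i))
    PIdisj w_gt0 wE (J := J k) (bxi (val k)) (Rad0 k) (Rad_diam k)).
  - by move=> i; rewrite inE => /eqP; exact: PR.
  - by have [] := VP k.
  - by have [] := VP k.
have Gdisj k k' x : G k x -> G k' x -> k = k'.
  move=> [i /=]; rewrite mem_enum inE => /eqP <- Pi [j /=].
  by rewrite mem_enum inE => /eqP <- Pj; rewrite (PIdisj i j x).
have f_outside : {ae leb, forall x, Omega x -> ~ (exists k, G k x) -> f x = 0}.
  have null_piece (i : 'I_N) :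
      {ae leb, forall x, ~ 0 < fine (W i) -> P i x -> f x = 0}.
    have [Wi|] := boolP (0 < fine (W i)).
      by apply: (@filterE _ _ (ae_filter_ringOfSetsType leb)) => x.
    rewrite -leNgt => Wi; have Wi0 : W i = 0%E.
      by apply/eqP; rewrite eq_le W_ge0 andbT -(fineK (W_fin i)) lee_fin.
    have mWi := measurable_div_delta oO b0 1 (mP i) (@PO i) mf.
    have [+ _] := ae_eq_integral_abs leb (mP i) mWi.
    have -> : (\int[leb]_(x in P i) `|(f x ^+ 2 / delta Omega x ^+ 1)%:E| = 0)%E.
      rewrite -[RHS]Wi0; apply: eq_integral => x _.
      by rewrite gee0_abs//; exact: density_ge0.
    move=> /(_ erefl); apply: ae_leb_sub => x + _ Pix => /(_ Pix) -[] /eqP.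
    rewrite mulf_eq0 invr_eq0 (gt_eqF (delta_gt0 oO b0 (PO i x Pix))) orbF.
    by rewrite expf_eq0 => /eqP.
  have := filterI (Filter := ae_filter_ringOfSetsType leb) fK
    (@filter_forall _ _ _ _ (ae_filter_ringOfSetsType leb) null_piece).
  apply: ae_leb_sub => x [fKx fPx] Ox noG; have [Kx|] := pselect (K x); last exact: fKx.
  have [i _ Pix] := KP x Kx; apply: (fPx i) => // Wi; apply: noG.
  pose i' : I := exist _ i Wi.
  by exists (l i'), i' => //=; rewrite mem_enum inE.
have [lambda [A [atomA cvgA sumA]]] := finite_atomic_sum alpha_gt0 p_gt0 oO b0
  (zero_atom p oO b0 O0 bO) (fun k => (atoms k).1) (fun k => (atoms k).2) Gdisj tf f_outside.
exists lambda, A; split; [exact: atomA|exact: cvgA|].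
rewrite sumA; apply: le_trans.
  suff -> : \sum_k `|lam k| `^ p =
      \sum_k ((\sum_(i | l i == k) w i) * V k `^ (2 / p - 1)) `^ (p / 2).
    apply: (lsum (fun k => eball (xi (val k)) (Rad k)) V M) => //.
    - by move=> k; apply: open_sigma_measurable; exact: open_eball.
    - by move=> k; have [] := VP k.
  apply: eq_bigr => k _; rewrite ger0_norm ?powR_ge0// /lam -powRrM.
  by rewrite (mulrC 2^-1).
pose Cs := C0 * ((1 + scale alpha) / scale alpha) ^+ n.
have -> : atomic_constant = 16 * M * Cs `^ (p / 2) by [].
have M16 : 0 <= 16 * M by exact: mulr_ge0.
rewrite (EFinM (16 * M)) -muleA lee_wpmul2l//.
rewrite (tent_norm_powR _ _ _ p_gt0).
have Cs0 : 0 <= Cs.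
  by rewrite mulr_ge0 ?(ltW C0_gt0)// exprn_ge0// divr_ge0 ?addr_ge0// ltW.
have area_ge0 := area_sq_ge0 alpha b0 f.
have m_area := measurable_area_sq_poweR alpha_gt0 oO b0 (p / 2) mf.
rewrite -(ge0_integralZl_EFin _ measurableT (fun eta _ => poweR_ge0 _ _) m_area
  (powR_ge0 _ _)).
apply: (ge0_le_integral _ measurableT).
- by move=> eta _; rewrite lee_fin powR_ge0.
- apply/measurable_EFinP; apply: measurable_dsq_powR => i.
  by apply: open_sigma_measurable; exact: open_eball.
- exact: measurable_funeM m_area.
move=> eta _; rewrite -poweR_EFin -[X in (_ <= X * _)%E]poweR_EFin -poweRM//.
apply: gt0_ler_poweR; rewrite ?divr_ge0 ?(ltW p_gt0)//.
- rewrite in_itv/= leey andbT lee_fin; apply: dsq_ge0 => // i.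
  by have [] := vP (val i).
- by rewrite in_itv/= leey andbT mule_ge0.
apply: (dsq_le_area alpha_gt0 C0_gt0 oO b0 mf (fun i => mP (val i))
  (fun i => PO (val i)) PIdisj w_gt0 wE).
- by move=> i; exact: yO.
- by move=> i x /PB[].
- by move=> i; exact: yxi.
- by move=> i; have [] := vP (val i).
Qed.

End atomic_decomposition.

Unset Implicit Arguments.

Theorem theorem2p19 (R : realType) (n : nat) (alpha p C0 c : R)
    (hn : (2 <= n)%N) (halpha : 0 < alpha) (hp0 : 0 < p) (hp1 : p <= 1)
    (hC0 : 0 < C0) (hc : 0 < c) :
  exists C : R, 0 < C /\
  forall Omega : set 'rV[R]_n.+1,
    open Omega -> Omega !=set0 ->
    corkscrew c Omega -> ahlfors_regular C0 (bdry Omega) ->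
    (bounded_set Omega \/ ~ bounded_set (bdry Omega)) ->
  forall f : 'rV[R]_n.+1 -> R,
    Linfty_c Omega f -> tent_space alpha p Omega f ->
  exists (lambda : nat -> R) (a : nat -> 'rV[R]_n.+1 -> R),
    [/\ forall j, tent_atom p Omega (a j),
        tent_cvg alpha p Omega
          (fun N x => \sum_(j < N) lambda j * a j x) f &
        (\sum_(j <oo) (`|lambda j| `^ p)%:E
          <= C%:E * tent_norm alpha p Omega f `^ p)%E].
Proof.
exists (atomic_constant (n := n) alpha p C0); split; first exact: atomic_constant_gt0.
move=> Omega oO O0 _ ahlfors bO f [_ _ [K [cK KO fK]]] tf.
exact: (atomic_decomposition halpha hp0 hp1 hC0 oO O0 bO ahlfors tf cK KO fK).
Qed.
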